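(* Let $\psi(z)=\sum_{k=0}^\infty \zeta_k \frac{z^k}{\sqrt{k!}}$, where $\zeta_0,\zeta_1,\zeta_2,\dots$ are independent standard complex Gaussian random variables, and for $r>0$ let $$p(r)=\mathbb P\big(\psi(z)\neq 0 \text{ for all } z\in\mathbb C \text{ with } |z|\le r\big).$$ Then there exist positive numerical constants $c$, $C$ and $r_0$ such that for all $r\ge r_0$ $$\exp(-C r^4)\le p(r)\le \exp(-c r^4).$$
   Context: A standard complex Gaussian random variable is a complex-valued random variable whose distribution has density $\pi^{-1}\exp(-|w|^2)$ with respect to Lebesgue measure on $\mathbb C$. Almost surely the series defining $\psi$ converges for all $z\in\mathbb C$ and defines an entire function. *)

(* Defs.v *)
From HB Require Import structures.
From mathcomp Require Import all_boot all_order all_algebra finmap complex.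
From mathcomp Require Import all_classical all_reals all_analysis.

Set Implicit Arguments.
Unset Strict Implicit.
Unset Printing Implicit Defensive.

Import Order.TTheory GRing.Theory Num.Theory numFieldNormedType.Exports.
Local Open Scope classical_set_scope.
Local Open Scope ring_scope.
Local Open Scope complex_scope.

(* The library has no Borel structure or Lebesgue measure on R[i]; both are
   those of R * R, transported along this identification. *)
Definition plane (R : realType) (w : R[i]) : R * R := (complex.Re w, complex.Im w).

(* [`|w|] lives in R[i] (it is a nonnegative real there), hence the [Re]. *)
Definition complex_gaussian_pdf (R : realType) (w : R[i]) : R :=
  pi^-1 * expR (- (complex.Re `|w|) ^+ 2).

Definition standard_complex_gaussian (R : realType) (d : measure_display)
    (T : measurableType d) (P : probability T R) (Z : T -> R[i]) : Prop :=
  measurable_fun [set: T] (@plane R \o Z) /\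
  forall B : set (R * R), measurable B ->
    P ((@plane R \o Z) @^-1` B) =
    (\int[(@lebesgue_measure R) \x (@lebesgue_measure R)]_(x in B)
       (complex_gaussian_pdf (x.1 +i* x.2))%:E)%E.

Definition independent_sequence (R : realType) (d : measure_display)
    (T : measurableType d) (P : probability T R) (Z : nat -> T -> R[i]) : Prop :=
  forall (J : {fset nat}) (B : nat -> set (R * R)),
    (forall k, k \in J -> measurable (B k)) ->
    P (\bigcap_(k in [set` J]) ((@plane R \o Z k) @^-1` B k)) =
    (\prod_(k <- J) P ((@plane R \o Z k) @^-1` B k))%E.

(* [R[i]^o] is R[i] with the topology induced by its norm. *)
Definition gef_partial_sums (R : realType) (a : nat -> R[i]) (z : R[i]) :
    nat -> R[i]^o :=
  series (fun k => a k * (z ^+ k / (Num.sqrt (k`!%:R : R))%:C) : R[i]^o).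

Definition gef (R : realType) (a : nat -> R[i]) (z : R[i]) : R[i] :=
  limn (gef_partial_sums a z).

(* The series converges at every z with probability one.  [limn] of a divergent
   sequence is an arbitrary default value, so the sample points at which
   convergence fails, a null set, are left out of the event. *)
Definition hole_event (R : realType) (T : Type) (zeta : nat -> T -> R[i])
    (r : R) : set T :=
  [set t | (forall z : R[i], cvgn (gef_partial_sums (zeta ^~ t) z)) /\
           (forall z : R[i], `|z| <= r%:C -> gef (zeta ^~ t) z <> 0)].

Definition hole_probability (R : realType) (d : measure_display)
    (T : measurableType d) (P : probability T R) (zeta : nat -> T -> R[i])
    (r : R) : \bar R :=
  P (hole_event zeta r).

(* Main.v *)
(* Upper bound.  If psi has no zero in the disk of radius r, neither has a long
   partial sum p, so p (r v) = a_0 * prod_i (1 - u_i v) with |u_i| < 1.  When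
   |psi| <= e^B on the disk, the Borel-Caratheodory inequality bounds the m-th
   power sum of the u_i by 2 m (B - ln |a_0|), and Newton's identities then give
   the k-th coefficient as an explicit function of the previous ones up to an
   error 2 |a_0| (B - ln |a_0|).  Off an event of probability O(exp (- r^4 / 2))
   this confines zeta_k, given zeta_0, ..., zeta_(k-1), to a square of side
   44 r^4 sqrt (k!) / r^k, which is exponentially small in k for k <= r^2 / 4.
   Multiplying about r^2 / 8 such conditional probabilities gives exp (- c r^4).
   In contrast with the usual proof, neither Jensen's formula nor a lower bound
   for |psi| on the circle is needed.

   Lower bound.  Independence lets zeta_0 be large, the next O(r^2) coefficients
   of size exp (- 2 r^2) and the remaining ones of moderate size; then the
   constant term dominates the series on the disk. *)
Require Import Defs.
From HB Require Import structures.
From mathcomp Require Import all_boot all_order all_algebra finmap complex.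
From mathcomp Require Import all_classical all_reals all_analysis.
From mathcomp Require Import measurable_realfun cyclic separable cyclotomic.
From mathcomp Require Import ring lra zify.
Set Implicit Arguments.
Unset Strict Implicit.
Unset Printing Implicit Defensive.
Import Order.TTheory GRing.Theory Num.Theory numFieldNormedType.Exports.
Local Open Scope classical_set_scope.
Local Open Scope ring_scope.
Local Open Scope complex_scope.

(** The centre of the window for zeta_(k+1) must be a function of zeta_0, ..., zeta_k alone, whereas
    the u_i, and even the degree of p, depend on the whole sample. Newton's identities remove this
    dependence: the lower power sums are recovered from the earlier coefficients, and the only
    unknown one enters through its product with a_0. The factor k+1 in the power sum bound cancels
    the k+1 of the identity, so the error involves neither k nor the degree of p. A tiny |a_0| does
    no harm because x ln (1/x) stays bounded.

    Borel-Caratheodory is discretised: averages over M-th roots of unity, with M tending to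
    infinity, replace integrals over the circle.

    With n0 the integer part of r^2 / 8, the windows used are those of zeta_(k+1) for n0 <= k < 2
    n0. The upper end keeps (k+1)! / r^(2(k+1)) below 4^-(k+1); the lower end makes this beat the
    factor r^8 coming from the squared window. Each window then costs 2^-n0, and n0 of them give
    2^-(n0^2). *)

Section Modulus.
Variable R : realType.
Implicit Types (x y : R) (z w : R[i]).

(* The norm of R[i] takes its values in R[i]; [nm] is the same number in R. *)
Definition nm (z : R[i]) : R := complex.Re `|z|.

Lemma normC_nm z : `|z| = (nm z)%:C.
Proof. by rewrite /nm normc_def. Qed.

Lemma nm_ge0 z : 0 <= nm z.
Proof. by rewrite -ler0c -normC_nm normr_ge0. Qed.

Lemma nm2 z : nm z ^+ 2 = complex.Re z ^+ 2 + complex.Im z ^+ 2.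
Proof. by rewrite /nm normc_def /= sqr_sqrtr // addr_ge0 // sqr_ge0. Qed.

Lemma nmM z w : nm (z * w) = nm z * nm w.
Proof. by apply: complexI; rewrite rmorphM /= -!normC_nm normrM. Qed.

Lemma nmX z n : nm (z ^+ n) = nm z ^+ n.
Proof. by apply: complexI; rewrite rmorphXn /= -!normC_nm normrX. Qed.

Lemma nmV z : nm z^-1 = (nm z)^-1.
Proof. by apply: complexI; rewrite fmorphV /= -!normC_nm normfV. Qed.

Lemma nmD z w : nm (z + w) <= nm z + nm w.
Proof. by rewrite -lecR rmorphD /= -!normC_nm ler_normD. Qed.

Lemma nmN z : nm (- z) = nm z.
Proof. by rewrite /nm normrN. Qed.

Lemma nm_distC z w : nm (z - w) = nm (w - z).
Proof. by rewrite /nm distrC. Qed.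

Lemma nm0 : nm 0 = 0.
Proof. by rewrite /nm normr0. Qed.

Lemma nm1 : nm 1 = 1.
Proof. by rewrite /nm normr1. Qed.

Lemma nm_eq0 z : (nm z == 0) = (z == 0).
Proof. by rewrite -(inj_eq (@complexI R)) -normC_nm normr_eq0. Qed.

Lemma nm_gt0 z : (0 < nm z) = (z != 0).
Proof. by rewrite lt_neqAle nm_ge0 andbT eq_sym nm_eq0. Qed.

Lemma nm_real x : nm x%:C = `|x|.
Proof. by rewrite /nm normc_def /= expr0n addr0 sqrtr_sqr. Qed.

Lemma le_Re_nm z : `|complex.Re z| <= nm z.
Proof. by rewrite -lecR -normC_nm normc_ge_Re. Qed.

Lemma le_Im_nm z : `|complex.Im z| <= nm z.
Proof.
rewrite -(ler_pXn2r (ltn0Sn 1)) ?nnegrE ?nm_ge0 ?normr_ge0 //.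
by rewrite real_normK ?num_real // nm2 lerDr sqr_ge0.
Qed.

Lemma nm_le_ReIm z : nm z <= `|complex.Re z| + `|complex.Im z|.
Proof.
rewrite -(ler_pXn2r (ltn0Sn 1)) ?nnegrE ?nm_ge0 ?addr_ge0 //.
rewrite nm2 sqrrD !real_normK ?num_real // lerD2r lerDl.
by rewrite mulrn_wge0 // mulr_ge0.
Qed.

Lemma nm_sum (I : Type) (s : seq I) (P : pred I) (F : I -> R[i]) :
  nm (\sum_(i <- s | P i) F i) <= \sum_(i <- s | P i) nm (F i).
Proof.
elim/big_ind2: _ => //; first by rewrite nm0.
by move=> a b c e ab ce; rewrite (le_trans (nmD _ _)) // lerD.
Qed.

Lemma nm_prod (I : Type) (s : seq I) (P : pred I) (F : I -> R[i]) :
  nm (\prod_(i <- s | P i) F i) = \prod_(i <- s | P i) nm (F i).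
Proof. by apply: (big_morph nm nmM nm1). Qed.

Lemma nm_dist_le z w : nm z - nm w <= nm (z - w).
Proof. by rewrite lerBlDr (le_trans _ (nmD _ _)) // subrK. Qed.

Lemma ReD z w : complex.Re (z + w) = complex.Re z + complex.Re w.
Proof. by case: z w => [a b] [c e]. Qed.

Lemma ImD z w : complex.Im (z + w) = complex.Im z + complex.Im w.
Proof. by case: z w => [a b] [c e]. Qed.

Lemma ReN z : complex.Re (- z) = - complex.Re z.
Proof. by case: z. Qed.

Lemma ImN z : complex.Im (- z) = - complex.Im z.
Proof. by case: z. Qed.

Lemma ReM z w : complex.Re (z * w) =
  complex.Re z * complex.Re w - complex.Im z * complex.Im w.
Proof. by case: z w => [a b] [c e]. Qed.

Lemma ImM z w : complex.Im (z * w) =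
  complex.Re z * complex.Im w + complex.Im z * complex.Re w.
Proof. by case: z w => [a b] [c e]. Qed.

Lemma Re_realM x z : complex.Re (x%:C * z) = x * complex.Re z.
Proof. by rewrite ReM /= mul0r subr0. Qed.

Lemma Re_sum (I : Type) (s : seq I) (P : pred I) (F : I -> R[i]) :
  complex.Re (\sum_(i <- s | P i) F i) = \sum_(i <- s | P i) complex.Re (F i).
Proof. exact: (big_morph _ ReD). Qed.

Lemma Im_sum (I : Type) (s : seq I) (P : pred I) (F : I -> R[i]) :
  complex.Im (\sum_(i <- s | P i) F i) = \sum_(i <- s | P i) complex.Im (F i).
Proof. exact: (big_morph _ ImD). Qed.

Lemma ReMRe z w : complex.Re z * complex.Re w =
  2^-1 * (complex.Re (z * w) + complex.Re (conjc z * w)).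
Proof. by case: z w => [a b] [c e] /=; field. Qed.

End Modulus.

(** * Taylor expansion of ln |1 - w| with explicit remainder *)

Section LogSeries.
Variable R : realType.
Implicit Types (t : R) (w z : R[i]).

(* At t = 1 this is the partial sum of - ln |1 - w|. *)
Definition logsum (w : R[i]) (K : nat) (t : R) : R :=
  \sum_(k < K) t ^+ k.+1 / k.+1%:R * complex.Re (w ^+ k.+1).

Lemma is_derive_scaled_exp (c : R) n t :
  is_derive t 1 (fun u : R => c / n.+1%:R * u ^+ n.+1) (c * t ^+ n).
Proof.
have -> : (fun u : R => c / n.+1%:R * u ^+ n.+1) = (c / n.+1%:R) \*: (@id R ^+ n.+1).
  by apply/funext => u; rewrite /GRing.scale /= exprfctE.
apply: is_derive_eq.
rewrite /GRing.scale /= mulr1 mulrA divfK //.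
Qed.

Lemma is_derive_logsum w K t :
  is_derive t 1 (logsum w K) (\sum_(k < K) t ^+ k * complex.Re (w ^+ k.+1)).
Proof.
have H (k : 'I_K) : is_derive t 1 (fun t : R => t ^+ k.+1 / k.+1%:R * complex.Re (w ^+ k.+1))
    (t ^+ k * complex.Re (w ^+ k.+1)).
  rewrite (_ : (fun t => _) = fun u => complex.Re (w ^+ k.+1) / k.+1%:R * u ^+ k.+1).
    by rewrite [t ^+ k * _]mulrC; exact: is_derive_scaled_exp.
  by apply/funext => u; rewrite mulrC mulrA mulrAC.
have := is_derive_sum (fun k => H k).
by congr is_derive; apply/funext => u; rewrite fct_sumE.
Qed.

(** This is ln |1 - t w| along the segment from 0 to w, written with the squared modulus to keep
    square roots out of the derivative. *)
Definition lognm (w : R[i]) (t : R) : R :=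
  2^-1 * ln ((1 - t * complex.Re w) ^+ 2 + (t * complex.Im w) ^+ 2).

Lemma lognmE w t : 1 - t%:C * w != 0 -> lognm w t = ln (nm (1 - t%:C * w)).
Proof.
move=> H; have n0 : 0 < nm (1 - t%:C * w) by rewrite nm_gt0.
rewrite /lognm.
have -> : (1 - t * complex.Re w) ^+ 2 + (t * complex.Im w) ^+ 2 = nm (1 - t%:C * w) ^+ 2.
  rewrite nm2; case: w {H n0} => a b /=; ring.
by rewrite lnXn // -(mulr_natl (ln _)) mulKf // pnatr_eq0.
Qed.

Lemma is_derive_lognm w t : 1 - t%:C * w != 0 ->
  is_derive t 1 (lognm w) (- complex.Re (w / (1 - t%:C * w))).
Proof.
case: w => a b H.
pose q (u : R) : R := (1 - u * a) ^+ 2 + (u * b) ^+ 2.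
have qt0 : 0 < q t.
  rewrite (_ : q t = nm (1 - t%:C * (a +i* b)) ^+ 2) ?exprn_gt0 ?nm_gt0 //.
  by rewrite nm2 /q /=; ring.
have dq : is_derive t 1 q (2 * (- (1 - t * a) * a + t * b ^+ 2)).
  have -> : q = (cst 1 - a \*: @id R) ^+ 2 + (b \*: @id R) ^+ 2.
    by apply/funext => u; rewrite /q /= fctE /= !exprfctE /= /GRing.scale /= ![u * _]mulrC.
  apply: is_derive_eq.
  rewrite /GRing.scale /= !fctE /= /GRing.scale /=.
  by ring.
have d1 := is_derive1_comp (is_derive1_ln qt0) dq.
have -> : lognm (a +i* b) = 2^-1 \*: (@ln R \o q) by apply/funext => u.
apply: is_derive_eq.
have Q : (1 - t * a) ^+ 2 + (t * b) ^+ 2 != 0 by rewrite gt_eqF.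
rewrite /GRing.scale /= /q.
field.
by rewrite sqrrN.
Qed.

Lemma subr_neq0_of_nm_lt1 w : nm w < 1 -> 1 - w != 0.
Proof. by apply: contraTneq => /eqP; rewrite subr_eq0 => /eqP <-; rewrite nm1 ltxx. Qed.

Lemma nm_subr_ge w : 1 - nm w <= nm (1 - w).
Proof. by rewrite -[X in X - _](@nm1 R) nm_dist_le. Qed.

Lemma nm_scaled_lt1 w t : 0 <= t <= 1 -> nm w < 1 -> nm (t%:C * w) <= nm w.
Proof.
move=> /andP[t0 t1] w1; rewrite nmM nm_real ger0_norm //.
by rewrite ler_piMl // nm_ge0.
Qed.

Lemma geometric_remainder w t K : 1 - t%:C * w != 0 ->
  - complex.Re (w / (1 - t%:C * w)) + \sum_(k < K) t ^+ k * complex.Re (w ^+ k.+1) =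
  - complex.Re (w * (t%:C * w) ^+ K / (1 - t%:C * w)).
Proof.
move=> H.
have -> : \sum_(k < K) t ^+ k * complex.Re (w ^+ k.+1) =
   complex.Re (w * \sum_(k < K) (t%:C * w) ^+ k).
  rewrite mulr_sumr Re_sum; apply: eq_bigr => k _.
  by rewrite exprMn mulrCA -rmorphXn /= Re_realM exprS.
rewrite -!ReN -ReD; congr complex.Re.
have -> : \sum_(k < K) (t%:C * w) ^+ k = (1 - (t%:C * w) ^+ K) / (1 - t%:C * w).
  by apply: (canRL (mulfK H)); rewrite mulrC -opprB mulNr -subrX1 opprB.
by field.
Qed.

(** Mean value theorem on [0, 1]: with t w in place of w, the sum vanishes at t = 0, and its
    derivative in t is the tail of a geometric series, of modulus at most |w|^(K+1) / (1 - |w|). *)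
Lemma log_series_bound w K : nm w < 1 ->
  `|ln (nm (1 - w)) + logsum w K 1| <= nm w ^+ K.+1 / (1 - nm w).
Proof.
move=> w1.
have nz t : 0 <= t <= 1 -> 1 - t%:C * w != 0.
  move=> t01; apply: subr_neq0_of_nm_lt1.
  by rewrite (le_lt_trans (nm_scaled_lt1 t01 w1)).
pose f : R -> R := lognm w + logsum w K.
have df t : t \in `[0, 1]%R ->
    is_derive t 1 f (- complex.Re (w * (t%:C * w) ^+ K / (1 - t%:C * w))).
  rewrite in_itv /= => /nz H; rewrite -geometric_remainder //.
  have := is_derive_lognm H; have := is_derive_logsum w K t => h1 h2.
  exact: is_deriveD.
have df' (x : R) : x \in `]0, 1[%R ->
    is_derive x 1 f (- complex.Re (w * (x%:C * w) ^+ K / (1 - x%:C * w))).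
  by move=> x01; apply: df; apply: subset_itvW x01.
have cf : {within `[0, 1], continuous f}.
  apply: derivable_within_continuous => x /df H.
  exact: ex_derive.
have [c c01 E] := MVT ltr01 df' cf.
have f0 : f 0 = 0.
  rewrite /f !fctE /lognm /logsum !mul0r subr0 expr1n expr0n addr0 ln1 mulr0 add0r.
  by apply: big1 => i _; rewrite expr0n !mul0r.
have f1 : f 1 = ln (nm (1 - w)) + logsum w K 1.
  by rewrite /f !fctE lognmE !mul1r // subr_neq0_of_nm_lt1.
move: E; rewrite f0 f1 !subr0 mulr1 => ->.
move: c01; rewrite in_itv /= => /andP[c0 c1].
have c01 : 0 <= c <= 1 by rewrite !ltW.
rewrite normrN (le_trans (le_Re_nm _)) // !nmM nmV nmX.
have h := nm_scaled_lt1 c01 w1.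
rewrite exprS; apply: ler_pM.
- by rewrite mulr_ge0 ?exprn_ge0 ?nm_ge0.
- by rewrite invr_ge0 nm_ge0.
- by rewrite ler_wpM2l ?nm_ge0 // lerXn2r ?nnegrE ?nm_ge0.
have p : 0 < 1 - nm w by rewrite subr_gt0.
have q : 1 - nm w <= nm (1 - c%:C * w).
  by rewrite (le_trans _ (nm_subr_ge _)) // lerD2l lerN2.
by rewrite lef_pV2 // posrE // (lt_le_trans p).
Qed.

End LogSeries.

(** * The Borel-Caratheodory inequality by averaging over roots of unity *)

Section BorelCaratheodory.
Variable R : realType.
Implicit Types (u v e w : R[i]).

Lemma prim_root_exists M : (0 < M)%N -> exists w : R[i], M.-primitive_root w.
Proof.
move=> M0; have [rs E] := closed_field_poly_normal ('X^M - 1 : {poly R[i]}).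
rewrite (monicP _) ?monicXnsubC // scale1r in E.
have rs1 : all M.-unity_root rs by apply/allP => z; rewrite -root_prod_XsubC -E.
have srs : (M < (size rs).+1)%N by rewrite -(size_prod_XsubC rs id) -E size_XnsubC.
have urs : uniq rs.
  by rewrite -separable_prod_XsubC -E separable_Xn_sub_1 // pnatr_eq0 -lt0n.
by have /hasP[w _ w_prim] := has_prim_root M0 rs1 urs srs; exists w.
Qed.

Section Dft.
Variables (M : nat) (w : R[i]).
Hypothesis (M0 : (0 < M)%N) (w_prim : M.-primitive_root w).

Lemma nm_prim_root : nm w = 1.
Proof.
have : nm w ^+ M = 1 by rewrite -nmX (prim_expr_order w_prim) nm1.
by move/eqP; rewrite pexpr_eq1 ?nm_ge0 // => /eqP.
Qed.

Lemma sum_prim_root k : \sum_(j < M) (w ^+ k) ^+ j = if (M %| k)%N then M%:R else 0.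
Proof.
case: ifPn => [Mk|Mk].
  have -> : w ^+ k = 1 by apply/eqP; rewrite -(prim_order_dvd w_prim).
  by under eq_bigr do rewrite expr1n; rewrite sumr_const card_ord.
apply/eqP; have/eqP : (w ^+ k - 1) * \sum_(j < M) (w ^+ k) ^+ j = 0.
  by rewrite -subrX1 exprAC (prim_expr_order w_prim) expr1n subrr.
by rewrite mulf_eq0 subr_eq0 -(prim_order_dvd w_prim) (negPf Mk).
Qed.

Lemma conj_prim_root : conjc w = w ^+ M.-1.
Proof.
have w0 : w != 0 by rewrite -nm_eq0 nm_prim_root oner_eq0.
apply: (mulfI w0); rewrite -exprS prednK // (prim_expr_order w_prim).
by rewrite -sqr_normc normC_nm nm_prim_root expr1n.
Qed.

(** The expanded product has the frequencies k, k + m and k - m, the last one written (M - 1) m + k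
    because conjugation of w is the power M - 1. The bounds on k and m keep all three nonzero modulo
    M, except k - m when k = m. *)
Lemma dft_monomial u e m k : (0 < m)%N -> (0 < k)%N -> (k + m < M)%N ->
  \sum_(j < M) (1 + complex.Re (e * w ^+ (j * m))) * complex.Re ((u * w ^+ j) ^+ k) =
  if k == m then M%:R / 2 * complex.Re (conjc e * u ^+ m) else 0.
Proof.
move=> m0 k0 kmM.
have E (j : 'I_M) : (1 + complex.Re (e * w ^+ (j * m))) * complex.Re ((u * w ^+ j) ^+ k) =
   complex.Re (u ^+ k * (w ^+ k) ^+ j) + 2^-1 * (complex.Re (e * u ^+ k * (w ^+ (m + k)) ^+ j)
     + complex.Re (conjc e * u ^+ k * (w ^+ (M.-1 * m + k)) ^+ j)).
  rewrite mulrDl mul1r ReMRe exprMn [w ^+ j ^+ k]exprAC; congr (_ + _ * (complex.Re _ + complex.Re _)).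
    by rewrite exprD exprMn mulrACA mulnC exprM.
  rewrite rmorphM rmorphXn /= conj_prim_root exprD exprMn mulrACA.
  by congr (_ * (_ * _)); rewrite -!exprM mulnAC mulnA.
rewrite (eq_bigr _ (fun j _ => E j)) big_split /= -mulr_sumr big_split /=.
rewrite -!Re_sum -!mulr_sumr !sum_prim_root.
have kM : (k < M)%N by rewrite (leq_ltn_trans (leq_addr m k)).
have mM : (m < M)%N by rewrite (leq_ltn_trans (leq_addl k m)).
rewrite (gtnNdvd k0 kM) addnC (gtnNdvd _ kmM) ?addn_gt0 ?k0 //.
rewrite !mulr0 !add0r.
have -> : (M %| M.-1 * m + k)%N = (k == m).
  have -> : (M.-1 * m + k = (m.-1 * M) + (k + (M - m)))%N.
    by case: (m) (M) m0 mM => [|p] [|n] //= _ pn; rewrite mulnS mulnS (mulnC n p); lia.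
  rewrite dvdn_addr ?dvdn_mull //.
  have [->|kNm] := eqVneq k m; first by rewrite subnKC ?dvdnn // ltnW.
  case: (ltngtP k m) kNm => // h _.
    by rewrite gtnNdvd //; lia.
  have -> : (k + (M - m) = (k - m) + M)%N by lia.
  by rewrite dvdn_addl // gtnNdvd //; lia.
case: eqP => [->|_]; last by rewrite !mulr0.
have -> : (M%:R : R[i]) = (M%:R : R)%:C by rewrite rmorph_nat.
by rewrite [_ * _%:C]mulrC Re_realM mulrA [2^-1 * _]mulrC.
Qed.

Lemma sum_dft_weight e m L : (0 < m < M)%N ->
  \sum_(j < M) (1 + complex.Re (e * w ^+ (j * m))) * L = M%:R * L.
Proof.
move=> /andP[m0 mM]; rewrite -mulr_suml; congr (_ * _).
rewrite big_split /= sumr_const card_ord -Re_sum -mulr_sumr.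
under eq_bigr do rewrite mulnC exprM.
by rewrite sum_prim_root gtnNdvd // mulr0 addr0.
Qed.

Lemma dft_weight_bounds e m j : nm e <= 1 ->
  0 <= 1 + complex.Re (e * w ^+ (j * m)) <= 2.
Proof.
move=> e1; have : `|complex.Re (e * w ^+ (j * m))| <= 1.
  by rewrite (le_trans (le_Re_nm _)) // nmM nmX nm_prim_root expr1n mulr1.
rewrite ler_norml; lra.
Qed.

(* The nonnegative weights 1 + Re (e w^(jm)) pick the m-th harmonic of
   ln |1 - u v| on the circle; M - m controls aliasing. *)
Lemma dft_log u e m : (0 < m)%N -> (m.*2 < M)%N -> nm e <= 1 -> nm u < 1 ->
  - (M%:R / 2 / m%:R * complex.Re (conjc e * u ^+ m))
     - M%:R * (2 * (nm u ^+ (M - m) / (1 - nm u)))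
  <= \sum_(j < M) (1 + complex.Re (e * w ^+ (j * m))) * ln (nm (1 - u * w ^+ j)).
Proof.
move=> m0 mM e1 u1; set K := (M - m).-1; set err := _ / (1 - nm u).
have SK : (M - m = K.+1)%N by rewrite /K; lia.
have nmuw j : nm (u * w ^+ j) = nm u.
  by rewrite nmM nmX nm_prim_root expr1n mulr1.
have err0 : 0 <= err by rewrite mulr_ge0 ?exprn_ge0 ?nm_ge0 // invr_ge0 subr_ge0 ltW.
have main : \sum_(j < M) (1 + complex.Re (e * w ^+ (j * m))) * logsum (u * w ^+ j) K 1 =
    M%:R / 2 / m%:R * complex.Re (conjc e * u ^+ m).
  transitivity (\sum_(k < K) k.+1%:R^-1 *
     \sum_(j < M) (1 + complex.Re (e * w ^+ (j * m))) * complex.Re ((u * w ^+ j) ^+ k.+1)).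
    rewrite /logsum; under eq_bigr do rewrite mulr_sumr.
    rewrite exchange_big /=; apply: eq_bigr => k _.
    rewrite mulr_sumr; apply: eq_bigr => j _.
    by rewrite expr1n mul1r mulrCA.
  have mK : (m.-1 < K)%N by rewrite /K; lia.
  rewrite (bigD1 (Ordinal mK)) //= [X in _ + X]big1 ?addr0 => [|k kNm].
     rewrite dft_monomial ?prednK //; last by lia.
    by rewrite eqxx mulrCA mulrA.
  rewrite dft_monomial ?ifF ?mulr0 //; last by have := ltn_ord k; rewrite /K; lia.
  by apply/negbTE; apply: contra kNm => /eqP km; apply/eqP/val_inj; rewrite /= -km.
rewrite -main -sumrN.
have -> : M%:R * (2 * err) = \sum_(j < M) (2 * err) by rewrite sumr_const card_ord mulr_natl.
rewrite -sumrB; apply: ler_sum => j _.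
have := log_series_bound K (w := u * w ^+ j); rewrite nmuw -SK -/err => /(_ u1).
have /andP[] := dft_weight_bounds m j e1.
set c := 1 + _; set x := ln _; set y := logsum _ _ _ => c0 c2.
rewrite ler_norml => /andP[h _].
have : c * (- err) <= c * (x + y) by rewrite ler_wpM2l.
have : c * err <= 2 * err by rewrite ler_wpM2r.
lra.
Qed.

End Dft.

Lemma ln_prod_nm (us : seq R[i]) v : (forall u, u \in us -> nm (1 - u * v) != 0) ->
  ln (\prod_(u <- us) nm (1 - u * v)) = \sum_(u <- us) ln (nm (1 - u * v)).
Proof.
move=> H; suff [] : 0 < \prod_(u <- us) nm (1 - u * v) /\
  ln (\prod_(u <- us) nm (1 - u * v)) = \sum_(u <- us) ln (nm (1 - u * v)) by [].
elim: us H => [_|u us IH H]; first by rewrite !big_nil ltr01 ln1.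
have [|p0 E] := IH; first by move=> x xus; apply: H; rewrite in_cons xus orbT.
have u0 : 0 < nm (1 - u * v) by rewrite lt_neqAle eq_sym H ?mem_head ?nm_ge0.
by rewrite !big_cons mulr_gt0 // lnM // E.
Qed.

(** Removes the aliasing error by letting the number of nodes tend to infinity. *)
Lemma le_of_le_add_geometric (x L C rho : R) n0 : 0 <= C -> 0 <= rho < 1 ->
  (forall n, (n0 <= n)%N -> x <= L + C * rho ^+ n) -> x <= L.
Proof.
move=> C0 /andP[rho0 rho1] H.
have cv : (fun n => L + C * rho ^+ n) @ \oo --> L + C * 0.
  apply: cvgD; first exact: cvg_cst.
  by apply: cvgMr; apply: cvg_expr; rewrite ger0_norm.
rewrite mulr0 addr0 in cv.
rewrite -(cvg_lim _ cv) //; apply: limr_ge; first by apply/cvg_ex; exists L.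
by exists n0.
Qed.

Lemma exists_common_radius (us : seq R[i]) : (forall u, u \in us -> nm u < 1) ->
  exists2 rho : R, 0 <= rho < 1 & forall u, u \in us -> nm u <= rho.
Proof.
elim: us => [_|u us IH H]; first by exists 0; rewrite ?lexx ?ltr01.
have [|rho /andP[rho0 rho1] rhoP] := IH.
  by move=> v vus; apply: H; rewrite in_cons vus orbT.
exists (Num.max (nm u) rho).
  by rewrite le_max rho0 orbT gt_max rho1 H ?mem_head.
move=> v; rewrite in_cons le_max => /orP[/eqP ->|/rhoP ->]; rewrite ?lexx ?orbT //.
Qed.

(* Borel-Caratheodory: ln of the product is harmonic, vanishes at 0, is at most
   L, and its m-th coefficient is minus the m-th power sum over m. *)
Lemma power_sum_bound (us : seq R[i]) (L : R) m : (0 < m)%N ->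
  (forall u, u \in us -> nm u < 1) ->
  (forall v, nm v = 1 -> \prod_(u <- us) nm (1 - u * v) <= expR L) ->
  nm (\sum_(u <- us) u ^+ m) <= 2 * m%:R * L.
Proof.
move=> m0 us1 H; set s := \sum_(u <- us) _.
have [rho rho01 rhoP] := exists_common_radius us1.
(* The phase that turns s to the negative real axis: conj(e) s = -|s|. If s = 0, division by zero
   gives e = 0, which still has modulus at most 1. *)
pose e := - s / (nm s)%:C.
have e1 : nm e <= 1.
  rewrite /e nmM nmN nmV nm_real ger0_norm ?nm_ge0 //.
  by have [->|s0] := eqVneq s 0; rewrite ?nm0 ?mul0r // mulfV ?nm_eq0.
have es : complex.Re (conjc e * s) = - nm s.
  have [s0|s0] := eqVneq s 0; first by rewrite s0 mulr0 nm0 oppr0.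
  have -> : e = (- (nm s)^-1)%:C * s by rewrite rmorphN fmorphV /e mulNr mulrC mulNr.
  have -> : conjc ((- (nm s)^-1)%:C * s) * s = (- (nm s)^-1)%:C * (s * conjc s).
    by rewrite rmorphM /= oppr0 mulrAC mulrA.
  rewrite -sqr_normc normC_nm -rmorphXn Re_realM /= expr2 mulNr mulKf //.
  by rewrite nm_eq0.
suff : nm s / (2 * m%:R) <= L.
  by rewrite ler_pdivrMr ?mulr_gt0 ?ltr0n // mulrC.
(* Starting at n = m + 1 ensures 2 m < n + m = M, as [dft_log] requires. *)
apply: (@le_of_le_add_geometric _ _ (2 * (size us)%:R / (1 - rho)) rho m.+1) => //.
  by rewrite !mulr_ge0 ?invr_ge0 ?subr_ge0 //; lra.
move=> n mn; pose M := (n + m)%N.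
have M0 : (0 < M)%N by rewrite addn_gt0 m0 orbT.
have [w w_prim] := prim_root_exists M0.
(* The weights are nonnegative with sum M, so they average the pointwise bound L; [D] below bounds
   the same average from below, factor by factor. *)
have S : \sum_(j < M) (1 + complex.Re (e * w ^+ (j * m))) *
     (\sum_(u <- us) ln (nm (1 - u * w ^+ j))) <= M%:R * L.
  rewrite -(sum_dft_weight w_prim e (m := m)) ?m0 ?/M; last by lia.
  apply: ler_sum => j _; apply: ler_wpM2l.
    by have /andP[] := dft_weight_bounds M0 w_prim m j e1.
  have w1 : nm (w ^+ j) = 1 by rewrite nmX (nm_prim_root M0 w_prim) expr1n.
  have P u : u \in us -> nm (1 - u * w ^+ j) != 0.
    move=> /us1 u1; rewrite nm_eq0 subr_neq0_of_nm_lt1 //.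
    by rewrite nmM w1 mulr1.
  rewrite -ln_prod_nm // -[leRHS]expRK ler_ln ?posrE ?expR_gt0 ?H //.
  rewrite big_seq; apply: prodr_gt0 => u /P.
  by rewrite lt_neqAle eq_sym nm_ge0 andbT.
have D u : u \in us -> 
    - (M%:R / 2 / m%:R * complex.Re (conjc e * u ^+ m)) - M%:R * (2 * (rho ^+ n / (1 - rho)))
  <= \sum_(j < M) (1 + complex.Re (e * w ^+ (j * m))) * ln (nm (1 - u * w ^+ j)).
  move=> uus; apply: le_trans (dft_log M0 w_prim _ _ _ _) => //.
  - rewrite lerD2l lerN2 ler_wpM2l ?ler0n // ler_wpM2l // /M addnK.
    apply: ler_pM; rewrite ?exprn_ge0 ?nm_ge0 ?invr_ge0 ?subr_ge0 ?(ltW (us1 _ uus)) //.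
      by rewrite lerXn2r ?nnegrE ?nm_ge0 ?rhoP //; lra.
    have := rhoP _ uus; rewrite lef_pV2 ?posrE ?subr_gt0 ?us1 //; first by lra.
    by lra.
  - by rewrite /M; lia.
  - exact: us1.
rewrite -(ler_pM2l (x := M%:R)) ?ltr0n //.
rewrite mulrDr -lerBlDr; apply: le_trans S.
under eq_bigr do rewrite mulr_sumr.
rewrite exchange_big /=.
apply: (@le_trans _ _ (\sum_(u <- us)
  (- (M%:R / 2 / m%:R * complex.Re (conjc e * u ^+ m)) - M%:R * (2 * (rho ^+ n / (1 - rho)))))).
  rewrite sumrB sumrN -mulr_sumr -Re_sum -mulr_sumr es big_const_seq count_predT iter_addr_0.
  rewrite -[X in _ <= _ - X]mulr_natr le_eqVlt; apply/orP; left; apply/eqP.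
  have m1 : (m%:R : R) != 0 by rewrite pnatr_eq0 -lt0n.
  have r1 : 1 - rho != 0 by move/andP: rho01 => [_ ?]; rewrite subr_eq0 gt_eqF.
  by field; rewrite m1 r1.
rewrite big_seq [leRHS]big_seq; exact: ler_sum.
Qed.
End BorelCaratheodory.

(** * Newton's identities and the prediction of the next coefficient *)

Section Newton.
Variable F : fieldType.
Implicit Types (us : seq F) (a : nat -> F).

(** The logarithmic derivative Q'/Q = - sum_m p_(m+1) X^m, where p_m is the m-th power sum, cleared
    of denominators and taken modulo X^K. *)
Lemma newton_poly us K : exists q : {poly F},
  (\prod_(u <- us) (1 - u *: 'X))^`() +
    (\prod_(u <- us) (1 - u *: 'X)) * \poly_(m < K) (\sum_(u <- us) u ^+ m.+1) = 'X^K * q.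
Proof.
elim: us => [|u us [q IH]].
  exists 0; rewrite !big_nil mul1r mulr0 derivC add0r.
  by apply/polyP => i; rewrite coef_poly big_nil coef0 if_same.
(* For a new factor 1 - u X, the derivative -u cancels the first term of the telescoped geometric
   sum u - u^(K+1) X^K; the second term joins the multiple of X^K. *)
exists ((1 - u *: 'X) * q - u ^+ K.+1 *: \prod_(v <- us) (1 - v *: 'X)).
rewrite !big_cons; set Q := \prod_(v <- us) _ in IH *.
have -> : \poly_(m < K) (\sum_(v <- u :: us) v ^+ m.+1) =
    \poly_(m < K) (u ^+ m.+1) + \poly_(m < K) (\sum_(v <- us) v ^+ m.+1) :> {poly F}.
  by apply/polyP => i; rewrite coefD !coef_poly; case: ifP; rewrite ?addr0 // big_cons.
have T : (1 - u *: 'X) * \poly_(m < K) (u ^+ m.+1) = u%:P - u ^+ K.+1 *: 'X^K.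
  have -> : \poly_(m < K) (u ^+ m.+1) = u *: \sum_(m < K) (u *: 'X) ^+ m.
    rewrite poly_def scaler_sumr; apply: eq_bigr => m _.
    by rewrite exprZn scalerA exprS.
  rewrite -scalerAr -[1 - _]opprB mulNr -subrX1 opprB scalerBr exprZn scalerA -exprS.
  by rewrite alg_polyC.
set S := \poly_(m < K) (\sum_(v <- us) v ^+ m.+1) in IH *.
rewrite derivM derivB derivC derivZ derivX sub0r mulrDr.
transitivity ((1 - u *: 'X) * (Q^`() + Q * S) + Q * ((1 - u *: 'X) * \poly_(m < K) (u ^+ m.+1)) - u *: 1 * Q).
  by ring.
rewrite IH T alg_polyC -!mul_polyC; ring.
Qed.

Lemma newton_identity us k : let Q := \prod_(u <- us) (1 - u *: 'X) in
  k.+1%:R * Q`_k.+1 = - \sum_(m < k.+1) (\sum_(u <- us) u ^+ m.+1) * Q`_(k - m).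
Proof.
move=> Q; have [q] := newton_poly us k.+1; rewrite -/Q => /(congr1 (coefp k)) /=.
rewrite coefD coef_deriv coefXnM ltnSn [Q * _]mulrC coefM => /eqP.
rewrite addr_eq0 mulr_natl => /eqP ->; congr (- _); apply: eq_bigr => m _.
by rewrite coef_poly ltn_ord.
Qed.

(* The j-th entry is the (j+1)-st power sum of the reciprocal roots of the
   series with coefficients a, solved from Newton's identities. *)
Fixpoint power_sums a n : seq F :=
  if n is k.+1 then
    let s := power_sums a k in
    rcons s (- (a 0%N)^-1 * (k.+1%:R * a k.+1 + \sum_(j < k) s`_j * a (k - j)%N))
  else [::].

(* The value of a_(k+1) for which the (k+1)-st power sum would be 0. *)
Definition next_coef a k : F := - k.+1%:R^-1 * \sum_(j < k) (power_sums a k)`_j * a (k - j)%N.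

Lemma size_power_sums a n : size (power_sums a n) = n.
Proof. by elim: n => //= n IH; rewrite size_rcons IH. Qed.

Lemma eq_power_sums a b n : (forall k, (k <= n)%N -> a k = b k) ->
  power_sums a n = power_sums b n.
Proof.
elim: n => //= n IH H; rewrite IH => [|k kn]; last by rewrite H // ltnW.
rewrite !H //; congr (rcons _ (_ * (_ + _))); apply: eq_bigr => j _.
by rewrite H // (leq_trans (leq_subr _ _)).
Qed.

(** This locality allows the coefficients of a long partial sum to be exchanged for those of the
    whole series. *)
Lemma eq_next_coef a b n : (forall k, (k <= n)%N -> a k = b k) ->
  next_coef a n = next_coef b n.
Proof.
move=> H; rewrite /next_coef (eq_power_sums H); congr (_ * _); apply: eq_bigr => j _.
by rewrite H // leq_subr.
Qed.

Lemma power_sums_newton a (s : nat -> F) n : a 0%N != 0 ->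
  (forall k, k.+1%:R * a k.+1 = - \sum_(m < k.+1) s m * a (k - m)%N) ->
  power_sums a n = mkseq s n.
Proof.
move=> a0 H; elim: n => //= n IH; rewrite mkseqS IH H big_ord_recr /= subnn opprD.
have -> : \sum_(j < n) (mkseq s n)`_j * a (n - j)%N = \sum_(j < n) s j * a (n - j)%N.
  by apply: eq_bigr => j _; rewrite nth_mkseq.
congr rcons.
by rewrite addrAC addNr add0r mulrNN mulrC mulfK.
Qed.

(** Of the terms in Newton's identity only the last, s_n a_0, is absent from the prediction, so it
    is the whole error. *)
Lemma next_coef_newton a (s : nat -> F) n : a 0%N != 0 -> n.+1%:R != 0 :> F ->
  (forall k, k.+1%:R * a k.+1 = - \sum_(m < k.+1) s m * a (k - m)%N) ->
  a n.+1 - next_coef a n = - (s n * a 0%N / n.+1%:R).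
Proof.
move=> a0 n0 H; rewrite /next_coef (power_sums_newton _ a0 H).
apply: (mulfI n0); rewrite mulrBr mulNr mulrN mulVKf // H big_ord_recr /= subnn.
have -> : \sum_(j < n) (mkseq s n)`_j * a (n - j)%N = \sum_(j < n) s j * a (n - j)%N.
  by apply: eq_bigr => j _; rewrite nth_mkseq.
rewrite opprD mulrN opprK [n.+1%:R * _]mulrC divfK // addrAC addNr add0r //.
Qed.

End Newton.

(** * Coefficients of a polynomial without zeros in the closed unit disk *)

Section KeyEstimate.
Variable R : realType.
Implicit Types (p : {poly R[i]}).

Lemma factor_outside_disk p : (forall v, nm v <= 1 -> p.[v] != 0) ->
  exists2 us : seq R[i], (forall u, u \in us -> nm u < 1) &
    p = p`_0 *: \prod_(u <- us) (1 - u *: 'X).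
Proof.
move=> H; have [rs E] := closed_field_poly_normal p.
have p0 : p != 0 by apply: contraTneq (H 0 _); rewrite ?nm0 // => ->; rewrite horner0 eqxx.
have rs1 z : z \in rs -> 1 < nm z.
  move=> zrs; rewrite ltNge; apply/negP => /H; rewrite E hornerZ mulf_eq0 lead_coef_eq0.
  by rewrite (negPf p0) -rootE root_prod_XsubC zrs.
exists [seq z^-1 | z <- rs].
  move=> u /mapP[z /rs1 z1 ->]; rewrite nmV invf_lt1 //; lra.
have rs0 z : z \in rs -> z != 0 by move=> /rs1 z1; rewrite -nm_gt0; lra.
have [c Ec] : exists c, p = c *: \prod_(u <- [seq z^-1 | z <- rs]) (1 - u *: 'X).
  rewrite E; move: (lead_coef p) => c; clear -rs0.
  elim: rs c rs0 => [|z rs IH] c H; first by exists c; rewrite !big_nil.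
  have [|c' E'] := IH (c * - z); first by move=> y yrs; apply: H; rewrite in_cons yrs orbT.
  exists c'; rewrite /= !big_cons.
  have -> : 'X - z%:P = - z *: (1 - z^-1 *: 'X).
    rewrite scalerBr scalerA mulNr mulfV ?H ?mem_head // scaleN1r opprK addrC.
    by rewrite scaleNr alg_polyC.
  by rewrite -scalerAl scalerA scalerAr E' -scalerAr.
rewrite {1}Ec; congr (_ *: _); rewrite Ec coefZ -horner_coef0 horner_prod big1 ?mulr1 // => u _.
by rewrite !hornerE subr0.
Qed.

(** [power_sum_bound] applies to p / p_0 with L = B - ln |p_0|; its factor n + 1 cancels the
    denominator in [next_coef_newton]. *)
Lemma coef_near_next_coef p (B : R) n : (forall v, nm v <= 1 -> p.[v] != 0) ->
  (forall v, nm v = 1 -> nm p.[v] <= expR B) ->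
  nm (p`_n.+1 - next_coef (fun k => p`_k) n) <= 2 * nm p`_0 * (B - ln (nm p`_0)).
Proof.
move=> pn0 pB; have [us us1 E] := factor_outside_disk pn0.
have p0 : p`_0 != 0 by rewrite -horner_coef0 pn0 // nm0.
have p0_gt0 : 0 < nm p`_0 by rewrite nm_gt0.
pose s m := \sum_(u <- us) u ^+ m.+1.
rewrite (next_coef_newton (s := s)) ?pnatr_eq0 //; last first.
  move=> k /=; rewrite E; set Q := \prod_(u <- us) _; rewrite coefZ mulrCA.
  rewrite (newton_identity us k) -/Q mulrN mulr_sumr; congr (- _).
  by apply: eq_bigr => m _; rewrite coefZ mulrCA.
have sL : nm (s n) <= 2 * n.+1%:R * (B - ln (nm p`_0)).
  apply: power_sum_bound => // v v1.
  have := pB v v1; rewrite E hornerZ nmM -E horner_prod nm_prod.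
  rewrite -ler_pdivlMl // => h; apply: le_trans (le_trans _ h) _.
    rewrite le_eqVlt; apply/orP; left; apply/eqP; apply: eq_bigr => u _.
    by rewrite !hornerE.
  by rewrite expRD expRN lnK // mulrC.
rewrite nmN nmM nmV nmM.
have -> : nm (n.+1%:R : R[i]) = n.+1%:R by rewrite -(rmorph_nat (real_complex R)) nm_real ger0_norm.
rewrite ler_pdivrMr ?ltr0n //.
apply: (le_trans (ler_wpM2r (nm_ge0 _) sL)).
by rewrite le_eqVlt; apply/orP; left; apply/eqP; ring.
Qed.

End KeyEstimate.

(** * Convergence of complex series through real sequences *)

Section ComplexSeries.
Variable R : realType.
Implicit Types (u t : nat -> R[i]^o) (l : R[i]^o).

Lemma nm_cvg u l : (u @ \oo --> l) <-> ((fun n => nm (u n - l)) @ \oo --> (0 : R)).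
Proof.
split=> H; apply/cvgrPdist_lt => e e0.
  move/cvgrPdist_lt/(_ e%:C): H; rewrite ltcR => /(_ e0).
  apply: filterS => n; rewrite sub0r normrN (ger0_norm (nm_ge0 _)) //.
  by rewrite distrC normC_nm ltcR.
(* In the order of R[i], a positive e has imaginary part 0. *)
have er : e = (complex.Re e)%:C by move: e0; case: (e) => a b; rewrite ltcE /= => /andP[/eqP ->].
move: e0; rewrite er ltcR => e0.
move/cvgrPdist_lt/(_ _ e0): H; apply: filterS => n.
rewrite sub0r normrN (ger0_norm (nm_ge0 _)) // => h.
by rewrite distrC normC_nm ltcR.
Qed.

Lemma cvg_ReIm u (a b : R) : (fun n => complex.Re (u n)) @ \oo --> a ->
  (fun n => complex.Im (u n)) @ \oo --> b -> u @ \oo --> (a +i* b : R[i]^o).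
Proof.
move=> ua ub; apply/nm_cvg.
apply: (@squeeze_cvgr _ _ _ _ (cst 0) (fun n => `|complex.Re (u n) - a| + `|complex.Im (u n) - b|)).
- apply: nearW => n /=; rewrite nm_ge0 /=.
  by rewrite (le_trans (nm_le_ReIm _)) // !(ReD, ImD, ReN, ImN).
- exact: cvg_cst.
- have dist0 (v : nat -> R) c : v @ \oo --> c -> (fun n => `|v n - c|) @ \oo --> (0 : R).
    move=> vc; rewrite -[X in _ --> X](@normr0 _ R) -(subrr c).
    by apply: cvg_norm; apply: cvgB; [exact: vc|exact: cvg_cst].
  by rewrite -[X in _ --> X]addr0; apply: cvgD; apply: dist0.
Qed.

Lemma nm_lim_le u l (c : R) (w : R[i]) : u @ \oo --> l ->
  (\forall n \near \oo, nm (u n - w) <= c) -> nm (l - w) <= c.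
Proof.
move=> /nm_cvg H cw; apply/ler_addgt0Pl => e e0.
have He := (cvgrPdist_lt _ _).1 H _ e0.
near \oo => n.
have h1 : nm (u n - w) <= c by near: n.
have h2 : nm (u n - l) < e.
  have : `|0 - nm (u n - l)| < e by near: n; exact: He.
  by rewrite sub0r normrN (ger0_norm (nm_ge0 _)).
have -> : l - w = (l - u n) + (u n - w) by rewrite addrA subrK.
by rewrite (le_trans (nmD _ _)) // lerD // nm_distC ltW.
Unshelve. all: by end_near. Qed.

Lemma nm_series_diff t (n N : nat) (b : nat -> R) : (n <= N)%N ->
  (forall k, nm (t k) <= b k) -> nm (series t N - series t n) <= \sum_(n <= k < N) b k.
Proof.
move=> nN tb; rewrite sub_series_geq //.
by rewrite (le_trans (nm_sum _ _ _)) // ler_sum.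
Qed.

Lemma sum_geometric_le (q : R) n N : 0 <= q < 1 -> (n <= N)%N ->
  \sum_(n <= k < N) q ^+ k <= q ^+ n / (1 - q).
Proof.
move=> /andP[q0 q1] nN; have q1' : 0 < 1 - q by rewrite subr_gt0.
rewrite ler_pdivlMr // mulrC -(subnKC nN); elim: (N - n)%N => [|d IH].
  by rewrite addn0 big_geq // mulr0 exprn_ge0.
suff -> : forall d, (1 - q) * \sum_(n <= k < n + d) q ^+ k = q ^+ n - q ^+ (n + d).
  by rewrite gerBl exprn_ge0.
elim=> [|d' IH']; first by rewrite addn0 big_geq // mulr0 subrr.
rewrite addnS big_nat_recr ?leq_addr //= mulrDr IH' exprS; ring.
Qed.

Lemma geometric_dominated_series t (C q : R) : 0 <= q < 1 ->
  (forall k, nm (t k) <= C * q ^+ k) ->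
  cvgn (series t) /\
  forall n, nm (limn (series t) - series t n) <= C * (q ^+ n / (1 - q)).
Proof.
move=> /andP[q0 q1] tC.
have C0 : 0 <= C by have := tC 0%N; rewrite expr0 mulr1; apply: le_trans; apply: nm_ge0.
have real_cvg (f : nat -> R) : (forall k, `|f k| <= nm (t k)) -> cvgn (series f).
  move=> fk; apply: normed_cvg; apply: (@series_le_cvg _ _ (geometric C q)) => //.
  - by move=> n; apply: normr_ge0.
  - by move=> n; rewrite /= mulr_ge0 ?exprn_ge0.
  - by move=> n /=; rewrite (le_trans (fk n)).
  - by apply: is_cvg_geometric_series; rewrite ger0_norm.
have cR := real_cvg _ (fun k => le_Re_nm (t k)).
have cI := real_cvg _ (fun k => le_Im_nm (t k)).
have ct : cvgn (series t).
  apply/cvg_ex; eexists; apply: (cvg_ReIm (a := limn (series (fun k => complex.Re (t k))))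
    (b := limn (series (fun k => complex.Im (t k))))).
    rewrite (_ : (fun n => _) = series (fun k => complex.Re (t k))) //.
    by apply/funext => n; rewrite /series /= Re_sum.
  rewrite (_ : (fun n => _) = series (fun k => complex.Im (t k))) //.
  by apply/funext => n; rewrite /series /= Im_sum.
split=> // n; apply: (nm_lim_le ct).
exists n => // N /= nN; rewrite (le_trans (nm_series_diff nN tC)) // -mulr_sumr.
by rewrite ler_wpM2l // sum_geometric_le // q0.
Qed.

End ComplexSeries.

(** * Growth of the coefficients, and uniform estimates on disks *)

Section EntireFunction.
Variable R : realType.
Implicit Types (a : nat -> R[i]) (z w : R[i]) (rho r : R).

Definition sqrt_fact k : R := Num.sqrt (k`!%:R).

Lemma sqrt_fact_gt0 k : 0 < sqrt_fact k.
Proof. by rewrite sqrtr_gt0 ltr0n fact_gt0. Qed.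

Lemma nm_gef_term a z k :
  nm (a k * (z ^+ k / (Num.sqrt (k`!%:R : R))%:C)) = nm (a k) * (nm z ^+ k / sqrt_fact k).
Proof. by rewrite !nmM nmV nmX nm_real ger0_norm ?sqrtr_ge0. Qed.

Lemma gef_partial_sumsE a z n : gef_partial_sums a z n =
  \sum_(k < n) a k * (z ^+ k / (Num.sqrt (k`!%:R : R))%:C).
Proof. by rewrite /gef_partial_sums /series /= big_mkord. Qed.

(** Equivalent to convergence at every point, but quantified over integers only, so that it defines
    a measurable event. *)
Definition entire_growth a := forall m : nat, exists C : nat, forall k,
  nm (a k) * (m%:R ^+ k / sqrt_fact k) <= C%:R.

Lemma entire_growth_of_cvg a : (forall z, cvgn (gef_partial_sums a z)) -> entire_growth a.
Proof.
move=> H m.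
have /cvg_ex[l] := H (m%:R%:C).
move=> /nm_cvg /cvgrPdist_lt /(_ 1 ltr01)[n0 _ n0P].
(* From n0 on, a term is the difference of two partial sums within 1 of the limit, whence the 2; the
   sum covers the earlier terms. *)
pose C0 := \sum_(k < n0) nm (a k) * (m%:R ^+ k / sqrt_fact k) + 2.
have [C CP] : exists C : nat, C0 <= C%:R.
  by exists (Num.truncn C0).+1; rewrite ltW // truncnS_gt.
exists C => k; apply: le_trans CP.
have t0 j : 0 <= nm (a j) * (m%:R ^+ j / sqrt_fact j).
  by rewrite mulr_ge0 ?nm_ge0 // mulr_ge0 ?exprn_ge0 // invr_ge0 ltW // sqrt_fact_gt0.
case: (ltnP k n0) => kn0.
  rewrite /C0 (bigD1 (Ordinal kn0)) //= -addrA lerDl addr_ge0 // sumr_ge0 //.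
have S n : (n0 <= n)%N -> nm (gef_partial_sums a m%:R%:C n - l) <= 1.
  by move=> /n0P /=; rewrite sub0r normrN (ger0_norm (nm_ge0 _)) => /ltW.
have E : nm (a k) * (m%:R ^+ k / sqrt_fact k) =
   nm ((gef_partial_sums a m%:R%:C k.+1 - l) - (gef_partial_sums a m%:R%:C k - l)).
  rewrite opprB addrA subrK !gef_partial_sumsE big_ord_recr /= addrAC subrr add0r.
  by rewrite nm_gef_term nm_real ger0_norm.
rewrite E (le_trans (nmD _ _)) // nmN /C0 (le_trans (lerD (S _ _) (S _ _))) //.
  by rewrite ltnW.
by rewrite lerDr sumr_ge0.
Qed.

(** Boundedness at an integer radius above 2 rho yields geometric decay at rho. *)
Lemma entire_growth_radius a rho : entire_growth a -> 0 <= rho ->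
  exists2 C : R, 0 <= C & forall k, nm (a k) * (rho ^+ k / sqrt_fact k) <= C * 2^-1 ^+ k.
Proof.
move=> G rho0; pose m := (Num.truncn (2 * rho)).+1.
have [C CP] := G m; exists C%:R => // k.
apply: le_trans (ler_wpM2r _ (CP k)); last by rewrite exprn_ge0.
rewrite -!mulrA ler_wpM2l ?nm_ge0 // mulrA mulrAC -exprMn.
rewrite ler_wpM2r ?invr_ge0 ?(ltW (sqrt_fact_gt0 _)) //.
rewrite lerXn2r ?nnegrE ?mulr_ge0 ?invr_ge0 //.
have : 2 * rho < m%:R by rewrite truncnS_gt.
lra.
Qed.

Lemma nm_gef_term_le a z rho k : nm z <= rho ->
  nm (a k * (z ^+ k / (Num.sqrt (k`!%:R : R))%:C)) <= nm (a k) * (rho ^+ k / sqrt_fact k).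
Proof.
move=> zr; rewrite nm_gef_term ler_wpM2l ?nm_ge0 // ler_wpM2r ?invr_ge0 ?(ltW (sqrt_fact_gt0 _)) //.
by rewrite lerXn2r ?nnegrE ?nm_ge0 // (le_trans (nm_ge0 z)).
Qed.

Lemma gef_cvg a z : entire_growth a -> cvgn (gef_partial_sums a z).
Proof.
move=> G; have [C C0 CP] := entire_growth_radius G (nm_ge0 z).
apply: (proj1 (geometric_dominated_series (C := C) (q := 2^-1) _ _)); first by lra.
by move=> k; apply: le_trans (CP k); apply: nm_gef_term_le.
Qed.

Lemma gef_uniform_cvg a rho (e : R) : entire_growth a -> 0 <= rho -> 0 < e ->
  exists n0 : nat, forall n z, (n0 <= n)%N -> nm z <= rho ->
    nm (gef a z - gef_partial_sums a z n) <= e.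
Proof.
move=> G rho0 e0; have [C C0 CP] := entire_growth_radius G rho0.
have [n0 n0P] : exists n0 : nat, C * (2^-1 ^+ n0 / (1 - 2^-1)) <= e.
  have : (fun n => C * (2^-1 ^+ n / (1 - 2^-1))) @ \oo --> (C * (0 / (1 - 2^-1)) : R).
    apply: cvgMr; apply: cvgMl; apply: cvg_expr; rewrite ger0_norm; lra.
  rewrite mul0r mulr0 => /cvgrPdist_le /(_ _ e0)[n _ /(_ n (leqnn n))].
  by rewrite /= sub0r normrN => /(le_trans (ler_norm _)) h; exists n.
exists n0 => n z nn0 zr; apply: le_trans n0P.
pose t k : R[i]^o := a k * (z ^+ k / (Num.sqrt (k`!%:R : R))%:C).
have [|k|_ H] := geometric_dominated_series (t := t) (C := C) (q := 2^-1).
- by lra.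
- by apply: le_trans (CP k); apply: nm_gef_term_le.
have h2 : 0 <= (1 - 2^-1 : R)^-1 by rewrite invr_ge0; lra.
apply: (le_trans (H n)); rewrite ler_wpM2l // ler_wpM2r //.
by rewrite ler_wiXn2l //; lra.
Qed.

(** The usual factor k rho^(k-1) is weakened to (2 rho)^k, which [entire_growth_radius] absorbs at
    radius 2 rho. *)
Lemma nm_exp_diff z w rho k : nm z <= rho -> nm w <= rho -> 1 <= rho ->
  nm (z ^+ k - w ^+ k) <= (2 * rho) ^+ k * nm (z - w).
Proof.
move=> zr wr r1; rewrite subrXX nmM mulrC ler_wpM2r ?nm_ge0 //.
apply: (le_trans (nm_sum _ _ _)); apply: (@le_trans _ _ (\sum_(i < k) rho ^+ k)).
  apply: ler_sum => i _; rewrite nmM !nmX.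
  have -> : rho ^+ k = rho ^+ (k - i.+1) * rho ^+ i * rho.
    by rewrite -exprD -exprSr; congr (_ ^+ _); have := ltn_ord i; lia.
  rewrite -[leLHS]mulr1; apply: ler_pM => //; rewrite ?mulr_ge0 ?exprn_ge0 ?nm_ge0 //.
  have rho0 : 0 <= rho by lra.
  have -> : (k - i.+1 = k.-1 - i)%N by have := ltn_ord i; lia.
  by apply: ler_pM; rewrite ?exprn_ge0 ?nm_ge0 ?lerXn2r ?nnegrE ?nm_ge0.

rewrite sumr_const card_ord -(mulr_natl (rho ^+ k)) exprMn ler_wpM2r ?exprn_ge0 //; [lra|].
by rewrite -natrX ler_nat ltnW // ltn_expl.
Qed.

(** L must not depend on n: lower bounds for all late partial sums are later carried from rational
    points to the whole disk. *)
Lemma gef_partial_sums_lipschitz a rho : entire_growth a -> 1 <= rho ->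
  exists2 L : R, 0 <= L & forall n z w, nm z <= rho -> nm w <= rho ->
    nm (gef_partial_sums a z n - gef_partial_sums a w n) <= L * nm (z - w).
Proof.
move=> G r1; have [|C C0 CP] := entire_growth_radius (rho := 2 * rho) G; first by lra.
exists (C * 2); first by lra.
move=> n z w zr wr; rewrite !gef_partial_sumsE -sumrB.
apply: (le_trans (nm_sum _ _ _)).
apply: (@le_trans _ _ (\sum_(k < n) C * 2^-1 ^+ k * nm (z - w))).
  apply: ler_sum => k _; rewrite -mulrBr -mulrBl !nmM nmV nm_real (ger0_norm (sqrtr_ge0 _)) -/(sqrt_fact k).
  apply: (@le_trans _ _ (nm (a k) * ((2 * rho) ^+ k / sqrt_fact k) * nm (z - w))).
    rewrite -!mulrA ler_wpM2l ?nm_ge0 // mulrA [leRHS]mulrAC.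
    by rewrite ler_wpM2r ?invr_ge0 ?(ltW (sqrt_fact_gt0 _)) // nm_exp_diff.
  by rewrite ler_wpM2r ?nm_ge0.
rewrite -mulr_suml -mulr_sumr ler_wpM2r ?nm_ge0 // ler_wpM2l //.
have := @sum_geometric_le R 2^-1 0 n; rewrite big_mkord expr0 => h.
have e2 : 1 / (1 - 2^-1) = 2 :> R by field.
by rewrite -[leRHS]e2; apply: h => //; lra.
Qed.

Lemma gef_lipschitz a rho : entire_growth a -> 1 <= rho ->
  exists2 L : R, 0 <= L & forall z w, nm z <= rho -> nm w <= rho ->
    nm (gef a z - gef a w) <= L * nm (z - w).
Proof.
move=> G r1; have [L L0 H] := gef_partial_sums_lipschitz G r1; exists L => // z w zr wr.
apply/ler_addgt0Pr => e e0.
have [||n1 n1P] := @gef_uniform_cvg a rho (e / 2) G; [lra|lra|].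
have hz := n1P _ _ (leqnn n1) zr; have hw := n1P _ _ (leqnn n1) wr.
rewrite nm_distC in hw.
have telescope (x y u v : R[i]) : x - v = (x - y) + ((y - u) + (u - v)) by ring.
rewrite (telescope _ (gef_partial_sums a z n1) (gef_partial_sums a w n1)).
rewrite (le_trans (nmD _ _)) // (le_trans (lerD hz (nmD _ _))) //.
have := H n1 z w zr wr; move: hw; lra.
Qed.

End EntireFunction.

(** * Absence of zeros in a disk as a countable condition *)

Section NonVanishing.
Variable R : realType.
Implicit Types (a : nat -> R[i]) (z w : R[i]) (rho r : R).

Lemma lipschitz_continuous2 (f : R * R -> R) :
  (forall p, exists2 L : R, 0 <= L & forall q, `|p.1 - q.1| < 1 -> `|p.2 - q.2| < 1 ->
     `|f p - f q| <= L * (`|p.1 - q.1| + `|p.2 - q.2|)) -> continuous f.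
Proof.
move=> H p; have [L L0 Lp] := H p; apply/cvgrPdist_le => e e0.
pose d := Num.min 1 (e / (2 * (L + 1))).
have d0 : 0 < d by rewrite lt_min ltr01 divr_gt0 //; lra.
have d1 : d <= 1 by rewrite ge_min lexx.
have dL : d * (2 * (L + 1)) <= e.
  by rewrite -ler_pdivlMr; [rewrite ge_min lexx orbT|lra].
have c1 : fst q @[q --> p] --> p.1 by exact: cvg_fst.
have c2 : snd q @[q --> p] --> p.2 by exact: cvg_snd.
have h1 := (cvgrPdist_lt _ _).1 c1 _ d0.
have h2 := (cvgrPdist_lt _ _).1 c2 _ d0.
near=> q.
have q1 : `|p.1 - q.1| < d by near: q; exact: h1.
have q2 : `|p.2 - q.2| < d by near: q; exact: h2.
apply: (le_trans (Lp q _ _)); rewrite ?(lt_le_trans _ d1) //.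
apply: le_trans dL.
have : L * (`|p.1 - q.1| + `|p.2 - q.2|) <= L * (2 * d) by rewrite ler_wpM2l //; lra.
lra.
Unshelve. all: by end_near. Qed.

Lemma nm_lipschitz z w : `|nm z - nm w| <= nm (z - w).
Proof. by rewrite ler_norml nm_dist_le lerNl opprB nm_distC nm_dist_le. Qed.

Lemma nm_pair_le (p q : R * R) :
  nm ((p.1 +i* p.2) - (q.1 +i* q.2)) <= `|p.1 - q.1| + `|p.2 - q.2|.
Proof. exact: nm_le_ReIm. Qed.

Lemma max0_lipschitz (u v : R) : `|Num.max u 0 - Num.max v 0| <= `|u - v|.
Proof.
have := ler_norm (u - v); have := ler_norm (v - u); rewrite (distrC v u) => h1 h2.
by case: (lerP u 0) => u0; case: (lerP v 0) => v0; rewrite ler_norml; lra.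
Qed.

Lemma nonvanishing_lower_bound a r : entire_growth a -> 0 < r ->
  (forall z, nm z <= r -> gef a z <> 0) ->
  exists2 c : R, 0 < c & forall z, nm z <= r -> c <= nm (gef a z).
Proof.
move=> G r0 H.
(* The second summand is positive off the disk, so that f can be minimized
   over the square. *)
pose f (p : R * R) := nm (gef a (p.1 +i* p.2)) + Num.max (nm (p.1 +i* p.2) - r) 0.
have fcont : continuous f.
  apply: lipschitz_continuous2 => p.
  pose rho := nm (p.1 +i* p.2) + 3.
  have [|L L0 LP] := gef_lipschitz (rho := rho) G.
    by rewrite /rho; have := nm_ge0 (p.1 +i* p.2); lra.
  exists (L + 1); first by lra.
  move=> q q1 q2; set z := p.1 +i* p.2; set w := q.1 +i* q.2.
  have zw : nm (z - w) <= `|p.1 - q.1| + `|p.2 - q.2| := nm_pair_le p q.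
  have zr : nm z <= rho by rewrite /rho -/z; lra.
  have wr : nm w <= rho.
    have := nm_dist_le w z; rewrite nm_distC /rho -/z => h; lra.
  apply: (@le_trans _ _ ((L + 1) * nm (z - w))); last by rewrite ler_wpM2l //; lra.
  have h1 := le_trans (nm_lipschitz (gef a z) (gef a w)) (LP z w zr wr).
  have h2 := nm_lipschitz z w.
  have h3 : `|Num.max (nm z - r) 0 - Num.max (nm w - r) 0| <= `|nm z - nm w|.
    rewrite (_ : nm z - nm w = (nm z - r) - (nm w - r)); last by ring.
    exact: max0_lipschitz.
  rewrite /f -/z -/w opprD addrACA (le_trans (ler_normD _ _)) // mulrDl mul1r lerD //.
  exact: le_trans h2.
have fpos p : 0 < f p.
  rewrite /f; case: (lerP (nm (p.1 +i* p.2)) r) => pr.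
    by rewrite ltr_wpDr ?le_max ?lexx ?orbT // nm_gt0; apply/eqP/H.
  by rewrite ltr_wpDl ?nm_ge0 // lt_max subr_gt0 pr.
have K : compact (`[- r, r]%classic `*` `[- r, r]%classic).
  by apply: compact_setX; apply: segment_compact.
have K0 : (`[- r, r]%classic `*` `[- r, r]%classic) !=set0.
  by exists (0, 0); split; rewrite /= in_itv /=; lra.
have [c _ cP] := compact_EVT_min K0 K (continuous_subspaceT fcont).
exists (f c) => // z zr.
have := cP (complex.Re z, complex.Im z).
have -> : f (complex.Re z, complex.Im z) = nm (gef a z).
  rewrite /f /= (_ : complex.Re z +i* complex.Im z = z); last by case: (z).
  by rewrite max_r ?addr0 // subr_le0.
apply; rewrite inE; split => /=; rewrite in_itv /= -ler_norml.
  exact: le_trans (le_Re_nm z) zr.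
exact: le_trans (le_Im_nm z) zr.
Qed.

Definition rat_point (p : rat * rat) : R[i] := ratr p.1 +i* ratr p.2.

(** Shrinking z by 1 - d first leaves room d r for the rational approximation, so that boundary
    points too are approached from within the disk. *)
Lemma rat_point_dense r z (e : R) : 0 < r -> nm z <= r -> 0 < e ->
  exists2 p, nm (rat_point p) <= r & nm (z - rat_point p) <= e.
Proof.
move=> r0 zr e0; pose d := Num.min 1 (e / (2 * r)).
have d0 : 0 < d by rewrite lt_min ltr01 divr_gt0 //; lra.
have d1 : d <= 1 by rewrite ge_min lexx.
have dr : d * (2 * r) <= e.
  by rewrite -ler_pdivlMr; [rewrite ge_min lexx orbT|lra].
have near_rat (x : R) : exists x' : rat, `|x - ratr x'| <= d * r / 2.
  have [|x' ] := @rat_in_itvoo R (x - d * r / 2) (x + d * r / 2).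
    by have := mulr_gt0 d0 r0; lra.
  rewrite in_itv /= => /andP[h1 h2]; exists x'; rewrite ler_norml; lra.
have [x' hx] := near_rat ((1 - d) * complex.Re z).
have [y' hy] := near_rat ((1 - d) * complex.Im z).
have h : nm ((1 - d)%:C * z - rat_point (x', y')) <= d * r.
  apply: (le_trans (nm_le_ReIm _)); rewrite ReD ImD ReN ImN /= Re_realM ImM /= mul0r addr0.
  lra.
have nz : nm ((1 - d)%:C * z) <= (1 - d) * r.
  by rewrite nmM nm_real ger0_norm ?ler_wpM2l //; lra.
exists (x', y').
  have := nm_dist_le (rat_point (x', y')) ((1 - d)%:C * z).
  rewrite nm_distC; lra.
have -> : z - rat_point (x', y') = d%:C * z + ((1 - d)%:C * z - rat_point (x', y')).
  by rewrite rmorphB rmorph1; ring.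
apply: (le_trans (nmD _ _)); rewrite nmM nm_real ger0_norm ?(ltW d0) //.
have : d * nm z <= d * r by rewrite ler_wpM2l // ltW.
lra.
Qed.

(* Only countably many inequalities on partial sums, hence the measurability of
   the hole event. *)
Definition uniformly_nonvanishing a r (q n0 : nat) :=
  forall n (p : rat * rat), (n0 <= n)%N -> nm (rat_point p) <= r ->
    q.+1%:R^-1 <= nm (gef_partial_sums a (rat_point p) n).

Lemma uniformly_nonvanishing_disk a r q n0 n z : entire_growth a -> 0 < r ->
  uniformly_nonvanishing a r q n0 -> (n0 <= n)%N -> nm z <= r ->
  q.+1%:R^-1 <= nm (gef_partial_sums a z n).
Proof.
move=> G r0 U nn0 zr.
have [|L L0 LP] := gef_partial_sums_lipschitz (rho := 1 + r) G; first by lra.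
apply/ler_addgt0Pr => e e0.
have e0' : 0 < e / (L + 1) by rewrite divr_gt0 //; lra.
have [p pr zp] := rat_point_dense r0 zr e0'.
have h1 := U n p nn0 pr.
have le_rho (x : R) : x <= r -> x <= 1 + r by lra.
have h2 := LP n z (rat_point p) (le_rho _ zr) (le_rho _ pr).
have h3 := nm_dist_le (gef_partial_sums a (rat_point p) n) (gef_partial_sums a z n).
rewrite nm_distC in h3.
have : L * nm (z - rat_point p) <= e.
  have : (L + 1) * nm (z - rat_point p) <= e.
    by rewrite mulrC -ler_pdivlMr //; lra.
  by have := nm_ge0 (z - rat_point p); lra.
by move=> h4; rewrite -lerBlDl (le_trans _ (le_trans h3 (le_trans h2 h4))) // lerB.
Qed.

(** Forwards, |psi| has a positive minimum on the disk, and half of it survives in all late partial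
    sums by uniform convergence. Backwards, partial sums bounded away from 0 cannot tend to 0. *)
Lemma gef_nonvanishingP a r : entire_growth a -> 0 < r ->
  (forall z, nm z <= r -> gef a z <> 0) <->
  (exists q n0, uniformly_nonvanishing a r q n0).
Proof.
move=> G r0; split=> [H|[q [n0 U]] z zr gz].
  have [c c0 cP] := nonvanishing_lower_bound G r0 H.
  have c20 : 0 < c / 2 by lra.
  have [n0 n0P] := gef_uniform_cvg G (ltW r0) c20.
  have [q qc] : exists q : nat, q.+1%:R^-1 <= c / 2.
    exists (Num.truncn (c / 2)^-1).
    by rewrite -[leRHS]invrK lef_pV2 ?posrE ?invr_gt0 // ltW // truncnS_gt.
  exists q, n0 => n p nn0 pr; apply: le_trans qc _.
  have h1 := n0P n _ nn0 pr; have h2 := cP _ pr.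
  have := nm_dist_le (gef a (rat_point p)) (gef_partial_sums a (rat_point p) n); lra.
have := gef_cvg (z := z) G; move/nm_cvg; rewrite -/(gef a z) gz.
have q0 : 0 < q.+1%:R^-1 :> R by rewrite invr_gt0.
move=> /cvgrPdist_lt/(_ _ q0)[n1 _ n1P].
have /= := n1P (maxn n0 n1) (leq_maxr _ _).
rewrite sub0r normrN subr0 (ger0_norm (nm_ge0 _)) ltNge.
by rewrite (uniformly_nonvanishing_disk G r0 U (leq_maxl _ _) zr).
Qed.

End NonVanishing.

(** * Deterministic estimates for both bounds *)

Section Deterministic.
Variable R : realType.
Implicit Types (a : nat -> R[i]) (z w : R[i]) (rho r x : R).

Lemma exp_div_fact_le x k : 0 <= x -> x ^+ k / k`!%:R <= expR x.
Proof.
case: k => [|k] x0; first by rewrite fact0 divr1 expr0 // (le_trans _ (expR_ge1Dx _)) // lerDl.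
by rewrite (le_trans _ (expR_ge1Dxn k x0)) // lerDr.
Qed.

Lemma exp_div_sqrt_fact_le x k : 0 <= x -> x ^+ k / sqrt_fact R k <= expR (x ^+ 2 / 2).
Proof.
move=> x0; rewrite -(ler_pXn2r (ltn0Sn 1)) ?nnegrE ?expR_ge0 //; last first.
  by rewrite divr_ge0 ?exprn_ge0 // ltW // sqrt_fact_gt0.
rewrite exprMn exprVn sqr_sqrtr // -exprM mulnC exprM.
have -> : expR (x ^+ 2 / 2) ^+ 2 = expR (x ^+ 2).
  by rewrite expr2 -expRD; congr expR; field.
by apply: exp_div_fact_le; rewrite exprn_ge0.
Qed.

Definition scaled_coef a r k : R[i] := a k * (r ^+ k / sqrt_fact R k)%:C.

Lemma horner_scaled_poly a r n v :
  (\poly_(k < n) scaled_coef a r k).[v] = gef_partial_sums a (r%:C * v) n.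
Proof.
rewrite horner_poly gef_partial_sumsE; apply: eq_bigr => k _.
rewrite /scaled_coef rmorphM fmorphV rmorphXn exprMn -/(sqrt_fact R k).
by rewrite -!mulrA; congr (_ * (_ * _)); rewrite mulrC.
Qed.

(** Since 2^k r^k = 2^-k (4 r)^k and (4 r)^k / sqrt (k!) <= exp (8 r^2), the sum is at most 2 r^2
    exp (8 r^2); the prefactor is absorbed in exp (2 r^2). *)
Lemma gef_partial_sums_le a r z n : 1 <= r ->
  (forall k, nm (a k) <= r ^+ 2 * 2 ^+ k) -> nm z <= r ->
  nm (gef_partial_sums a z n) <= expR (10 * r ^+ 2).
Proof.
move=> r1 ar zr; have r0 : 0 <= r by lra.
apply: (@le_trans _ _ (\sum_(0 <= k < n) (r ^+ 2 * expR (8 * r ^+ 2)) * 2^-1 ^+ k)).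
  rewrite gef_partial_sumsE big_mkord (le_trans (nm_sum _ _ _)) //; apply: ler_sum => k _.
  apply: (le_trans (nm_gef_term_le _ _ zr)).
  have h := @exp_div_sqrt_fact_le (4 * r) k (mulr_ge0 (ler0n _ 4) r0).
  have E : (4 * r) ^+ 2 / 2 = 8 * r ^+ 2 by rewrite expr2; field.
  rewrite E in h.
  have t0 : 0 <= r ^+ k / sqrt_fact R k.
    by rewrite divr_ge0 ?exprn_ge0 // ltW // sqrt_fact_gt0.
  apply: (le_trans (ler_wpM2r t0 (ar k))).
  rewrite -[leLHS]mulrA -[leRHS]mulrA ler_wpM2l ?exprn_ge0 //.
  have i0 : 0 <= 2^-1 ^+ k :> R by rewrite exprn_ge0.
  apply: (le_trans _ (ler_wpM2r i0 h)).
  rewrite mulrAC -exprMn (_ : 4 * r * 2^-1 = 2 * r); last by field.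
  by rewrite exprMn mulrA.
rewrite -mulr_sumr.
have h := @sum_geometric_le R 2^-1 0 n; rewrite expr0 in h.
have h2 : \sum_(0 <= k < n) 2^-1 ^+ k <= 2 :> R.
  have e2 : 1 / (1 - 2^-1) = 2 :> R by field.
  by rewrite -[leRHS]e2; apply: h => //; lra.
have e0 := expR_ge0 (8 * r ^+ 2).
apply: (@le_trans _ _ (r ^+ 2 * expR (8 * r ^+ 2) * 2)).
  by rewrite ler_wpM2l // mulr_ge0 // exprn_ge0.
have -> : 10 * r ^+ 2 = 8 * r ^+ 2 + 2 * r ^+ 2 by ring.
rewrite expRD mulrC mulrA [leRHS]mulrC ler_wpM2r //.
by rewrite (le_trans _ (expR_ge1Dx _)) // lerDr.
Qed.

(** Since x ln (1/x) <= 1, the bound stays uniform as x tends to 0; this is what handles a small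
    constant coefficient. *)
Lemma mul_sub_ln_le (x M B : R) : 0 < x -> x <= M -> 0 <= B -> x * (B - ln x) <= M * B + 1.
Proof.
move=> x0 xM B0; rewrite mulrBr lerD ?ler_wpM2r //.
have := ln_sublinear (x := x^-1); rewrite invr_gt0 lnV ?posrE // => /(_ x0) h.
have : x * (- ln x) <= x * x^-1 by rewrite ler_wpM2l // ltW.
by rewrite mulrN mulfV // gt_eqF.
Qed.

Lemma hole_coef_estimate a r k : 1 <= r ->
  (forall z, cvgn (gef_partial_sums a z)) -> (forall z, nm z <= r -> gef a z <> 0) ->
  (forall k, nm (a k) <= r ^+ 2 * 2 ^+ k) ->
  nm (scaled_coef a r k.+1 - next_coef (scaled_coef a r) k) <= 22 * r ^+ 4.
Proof.
move=> r1 cv nv ar; have r0 : 0 < r by lra.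
have G := entire_growth_of_cvg cv.
have [q [n0 U]] := (gef_nonvanishingP G r0).1 nv.
(* The partial sum is long enough to have no zeros (n0) and to contain the coefficient k + 1. Its
   length depends on the sample, but the final bound does not. *)
pose N := maxn n0 k.+2; pose p := \poly_(k < N) scaled_coef a r k.
have kN j : (j <= k.+1)%N -> (j < N)%N by move=> jk; rewrite /N leq_max ltnS jk orbT.
have pE j : (j <= k.+1)%N -> p`_j = scaled_coef a r j by move=> jk; rewrite coef_poly kN.
have rv v : nm v <= 1 -> nm (r%:C * v) <= r.
  by move=> v1; rewrite nmM nm_real (ger0_norm (ltW r0)) ler_piMr // ltW.
have pn0 v : nm v <= 1 -> p.[v] != 0.
  move=> /rv v1; rewrite horner_scaled_poly -nm_gt0.
  apply: lt_le_trans (uniformly_nonvanishing_disk G r0 U (leq_maxl _ _) v1).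
  by rewrite invr_gt0.
have pB v : nm v = 1 -> nm p.[v] <= expR (10 * r ^+ 2).
  by move=> v1; rewrite horner_scaled_poly gef_partial_sums_le // rv // v1.
have := coef_near_next_coef k pn0 pB.
rewrite (eq_next_coef (b := scaled_coef a r)); last by move=> j jk; rewrite pE // ltnW.
rewrite pE // => /le_trans; apply.
have p0 : nm p`_0 = nm (a 0%N).
  rewrite pE // /scaled_coef /sqrt_fact expr0 fact0 sqrtr1 divr1 mulr1 //.
have p00 : 0 < nm p`_0 by rewrite nm_gt0 -horner_coef0 pn0 // nm0.
have p0r : nm p`_0 <= r ^+ 2 by have := ar 0%N; rewrite p0 expr0 mulr1.
have h := mul_sub_ln_le p00 p0r (mulr_ge0 (ler0n _ 10) (exprn_ge0 2 (ltW r0))).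
have r4 : 1 <= r ^+ 4 by rewrite exprn_ege1.
have E : r ^+ 2 * (10 * r ^+ 2) = 10 * r ^+ 4 by ring.
by rewrite -mulrA; move: h; rewrite E; lra.
Qed.

Lemma hole_of_dominant_coef a r z : entire_growth a ->
  (forall k, nm (a k.+1) * (r ^+ k.+1 / sqrt_fact R k.+1) <= 2^-1 ^+ k.+1) ->
  2 <= complex.Re (a 0%N) -> nm z <= r -> gef a z <> 0.
Proof.
move=> G ar a0 zr gz.
have : nm (gef a z - a 0%N) <= 1.
  apply: (nm_lim_le (gef_cvg (z := z) G)); exists 1%N => // n /= n1.
  rewrite -(prednK n1) gef_partial_sumsE big_ord_recl expr0 fact0 sqrtr1 divr1 mulr1.
  rewrite addrAC subrr add0r (le_trans (nm_sum _ _ _)) //.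
  apply: (@le_trans _ _ (\sum_(1 <= k < n) 2^-1 ^+ k)).
    rewrite big_add1 big_mkord; apply: ler_sum => k _.
    exact: le_trans (nm_gef_term_le _ _ zr) (ar k).
  have h := @sum_geometric_le R 2^-1 1 n; rewrite expr1 in h.
  have e2 : 2^-1 / (1 - 2^-1) = 1 :> R by field.
  by rewrite -[leRHS]e2; apply: h => //; lra.
rewrite gz sub0r nmN => h; have := le_trans (ler_norm _) (le_Re_nm (a 0%N)).
lra.
Qed.

Lemma entire_growth_of_le a (C : R) : (forall k, nm (a k) <= C * 2 ^+ k) -> entire_growth a.
Proof.
move=> aC m; have C0 : 0 <= C by have := aC 0%N; rewrite expr0 mulr1; apply: le_trans; apply: nm_ge0.
pose D := C * expR ((2 * m%:R) ^+ 2 / 2).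
exists (Num.truncn D).+1 => k; apply: le_trans (ltW (truncnS_gt D)).
have t0 : 0 <= m%:R ^+ k / sqrt_fact R k.
  by rewrite divr_ge0 ?exprn_ge0 // ltW // sqrt_fact_gt0.
apply: (le_trans (ler_wpM2r t0 (aC k))); rewrite -mulrA ler_wpM2l // mulrA -exprMn.
by apply: exp_div_sqrt_fact_le; rewrite mulr_ge0.
Qed.

(** Weak Stirling bound k! >= (k / e)^k, read off from k^k / k! <= e^k. *)
Lemma power_le_fact (x : R) k : 0 <= x -> x * expR 1 <= k%:R -> x ^+ k <= k`!%:R.
Proof.
move=> x0 xk; have := @exp_div_fact_le k%:R k (ler0n _ _).
rewrite ler_pdivrMr ?ltr0n ?fact_gt0 // -[X in expR X]mul1r expRM_natr => h.
have : (x * expR 1) ^+ k <= expR 1 ^+ k * k`!%:R.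
  by apply: le_trans h; rewrite lerXn2r ?nnegrE // mulr_ge0 // expR_ge0.
by rewrite exprMn mulrC ler_pM2l // exprn_gt0 // expR_gt0.
Qed.

(** The condition on k gives (8 r)^k <= sqrt (k!), while 2 * 2^k r^k <= (4 r)^k = 2^-k (8 r)^k for k
    > 0. *)
Lemma tail_coef_le r (A : R) k : 0 <= r -> 64 * r ^+ 2 * expR 1 <= k%:R -> (0 < k)%N ->
  A <= 2 * 2 ^+ k -> A * (r ^+ k / sqrt_fact R k) <= 2^-1 ^+ k.
Proof.
move=> r0 kr k0 Ak; have s0 := sqrt_fact_gt0 R k.
have h : (8 * r) ^+ k <= sqrt_fact R k.
  rewrite -(ler_pXn2r (ltn0Sn 1)) ?nnegrE ?exprn_ge0 ?mulr_ge0 ?(ltW s0) //.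
  rewrite sqr_sqrtr // -exprM mulnC exprM; apply: power_le_fact; first by rewrite exprn_ge0 // mulr_ge0.
  by rewrite (_ : (8 * r) ^+ 2 = 64 * r ^+ 2) //; ring.
have t0 : 0 <= r ^+ k / sqrt_fact R k by rewrite divr_ge0 ?exprn_ge0 // ltW.
apply: (le_trans (ler_wpM2r t0 Ak)).
rewrite mulrA ler_pdivrMr //.
apply: (@le_trans _ _ (2^-1 ^+ k * (8 * r) ^+ k)); last by rewrite ler_wpM2l // exprn_ge0.
rewrite -exprMn (_ : 2^-1 * (8 * r) = 2 * (2 * r)); last by field.
rewrite [leRHS]exprMn -[leLHS]mulrA -[X in 2 * X <= _]exprMn ler_wpM2r ?exprn_ge0 ?mulr_ge0 //.
by rewrite -[X in X <= _]expr1 ler_eXn2l //; lra.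
Qed.

(** Here r^k = 2^-k (2 r)^k, and (2 r)^k / sqrt (k!) <= exp (2 r^2); hence the size demanded of the
    early coefficients. *)
Lemma head_coef_le r (A : R) k : 0 <= r -> A <= expR (- (2 * r ^+ 2)) ->
  A * (r ^+ k / sqrt_fact R k) <= 2^-1 ^+ k.
Proof.
move=> r0 Ak.
have t0 : 0 <= r ^+ k / sqrt_fact R k.
  by rewrite divr_ge0 ?exprn_ge0 // ltW // sqrt_fact_gt0.
apply: (le_trans (ler_wpM2r t0 Ak)).
have := @exp_div_sqrt_fact_le (2 * r) k (mulr_ge0 (ler0n _ 2) r0).
rewrite (_ : (2 * r) ^+ 2 / 2 = 2 * r ^+ 2); last by rewrite expr2; field.
move=> h; have := ler_wpM2l (expR_ge0 (- (2 * r ^+ 2))) h.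
rewrite -expRD addNr expR0 exprMn -[_ * _ / _]mulrA mulrCA => h2.
by rewrite exprVn -[leRHS]mul1r ler_pdivlMr ?exprn_gt0 // mulrC.
Qed.

End Deterministic.

(** * Gaussian probabilities of boxes and tails *)

Section Gaussian.
Variables (R : realType) (d : measure_display) (T : measurableType d)
  (P : probability T R) (Z : T -> R[i]).
Hypothesis HZ : standard_complex_gaussian P Z.
Local Notation leb2 := ((@lebesgue_measure R) \x (@lebesgue_measure R))%E.
Implicit Types (B : set (R * R)).

Definition plane_pdf (p : R * R) : R := pi^-1 * expR (- (p.1 ^+ 2 + p.2 ^+ 2)).

Lemma plane_pdfE p : complex_gaussian_pdf (p.1 +i* p.2) = plane_pdf p.
Proof. by rewrite /complex_gaussian_pdf normc_def /= sqr_sqrtr // addr_ge0 // sqr_ge0. Qed.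

Lemma measurable_plane_pdf B : measurable_fun B plane_pdf.
Proof.
apply: measurable_funTS; apply: measurable_funM; first exact: measurable_cst.
apply: measurableT_comp => //; apply: measurableT_comp; first exact: oppr_measurable.
by apply: measurable_funD; apply: measurable_funX; [exact: measurable_fst|exact: measurable_snd].
Qed.

Lemma plane_pdf_ge0 p : 0 <= plane_pdf p.
Proof. by rewrite mulr_ge0 ?expR_ge0 // invr_ge0 pi_ge0. Qed.

Lemma inv_pi_le1 : (pi : R)^-1 <= 1.
Proof. by rewrite invf_le1 ?pi_gt0 // (le_trans _ (pi_ge2 R)) //; lra. Qed.

Lemma plane_pdf_le1 p : plane_pdf p <= 1.
Proof.
rewrite -[leRHS]mulr1; apply: ler_pM; rewrite ?expR_ge0 ?invr_ge0 ?pi_ge0 ?inv_pi_le1 //.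
by rewrite -[leRHS]expR0 ler_expR oppr_le0 addr_ge0 // sqr_ge0.
Qed.

Lemma gaussian_law B : measurable B ->
  P ((@plane R \o Z) @^-1` B) = (\int[leb2]_(p in B) (plane_pdf p)%:E)%E.
Proof.
by move=> mB; rewrite HZ.2 //; apply: eq_integral => p _; rewrite plane_pdfE.
Qed.

Definition box (a b s : R) : set (R * R) := `[a, a + s]%classic `*` `[b, b + s]%classic.

Lemma measurable_box a b s : measurable (box a b s).
Proof. by apply: measurableX; exact: measurable_itv. Qed.

Lemma leb2_box a b s : 0 <= s -> leb2 (box a b s) = ((s ^+ 2)%:E)%E.
Proof.
move=> s0; rewrite product_measure1E //=.
have itv (x : R) : lebesgue_measure `[x, x + s]%classic = s%:E.
  rewrite lebesgue_measure_itv /= lte_fin; case: ifPn => [_|].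
    by rewrite -EFinB addrC addKr.
  by rewrite -leNgt gerDl => s1; congr (_%:E); apply/eqP; rewrite eq_le s0 s1.
by rewrite !itv -EFinM expr2.
Qed.

Lemma gaussian_box_le B a b s : 0 <= s -> measurable B -> B `<=` box a b s ->
  (P ((@plane R \o Z) @^-1` B) <= (s ^+ 2)%:E)%E.
Proof.
move=> s0 mB Bs; rewrite gaussian_law // -(leb2_box a b s0).
apply: (@le_trans _ _ (\int[leb2]_(p in B) (cst 1 p))%E).
  apply: ge0_le_integral => //.
  - by move=> p _; rewrite lee_fin plane_pdf_ge0.
  - by apply/measurable_EFinP; exact: measurable_plane_pdf.
  - by move=> p _; rewrite lee_fin plane_pdf_le1.
rewrite integral_cst // mul1e; apply: le_measure => //; rewrite inE //.
exact: measurable_box.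
Qed.

Lemma gaussian_box_ge a b s c : 0 <= s -> 0 <= c ->
  (forall p, box a b s p -> c <= plane_pdf p) ->
  ((c * s ^+ 2)%:E <= P ((@plane R \o Z) @^-1` (box a b s)))%E.
Proof.
move=> s0 c0 H; rewrite gaussian_law; last exact: measurable_box.
rewrite EFinM -(leb2_box a b s0) -integral_cst; last exact: measurable_box.
apply: ge0_le_integral => //.
- exact: measurable_box.
- by apply/measurable_EFinP; exact: measurable_plane_pdf.
Qed.

Lemma integral_normal_pdf2 :
  (\int[leb2]_p (normal_pdf 0 1 p.1 * normal_pdf 0 1 p.2)%:E = 1)%E.
Proof.
rewrite fubini_tonelli1 //=.
- rewrite -[RHS](integral_normal_pdf (0 : R) 1); apply: eq_integral => x _.
  rewrite /fubini_F /=; under eq_integral do rewrite EFinM.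
  rewrite ge0_integralZl //=; first by rewrite integral_normal_pdf mule1.
  + by apply/measurable_EFinP; exact: measurable_normal_pdf.
  + by move=> y _; rewrite lee_fin normal_pdf_ge0.
  + by rewrite lee_fin normal_pdf_ge0.
- apply/measurable_EFinP; apply: measurable_funM; apply: measurableT_comp => //;
  exact: measurable_normal_pdf.
- by move=> p; rewrite lee_fin mulr_ge0 // normal_pdf_ge0.
Qed.

Lemma normal_pdf01 (x : R) : normal_pdf 0 1 x = (Num.sqrt (2 * pi))^-1 * expR (- (x ^+ 2 / 2)).
Proof.
by rewrite normal_pdfE ?oner_neq0 // /normal_peak /normal_fun subr0 expr1n mul1r mulr_natl mulNr.
Qed.

(** Half of the exponent stays outside as decay and the other half is a probability density, so
    tails need no polar coordinates, at the price of a factor 2 and half the rate. *)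
Lemma plane_pdf_normal p :
  plane_pdf p = 2 * expR (- ((p.1 ^+ 2 + p.2 ^+ 2) / 2)) * (normal_pdf 0 1 p.1 * normal_pdf 0 1 p.2).
Proof.
rewrite !normal_pdf01 /plane_pdf; set s := Num.sqrt _.
have s2 : s^-1 * s^-1 = (2 * pi)^-1.
  by rewrite -invfM -expr2 sqr_sqrtr // mulr_ge0 // pi_ge0.
rewrite [X in _ = _ * X]mulrACA s2 [RHS]mulrACA -!expRD invfM [2 * (_ * _)]mulrA mulfV ?pnatr_eq0 // mul1r.
by congr (_ * expR _); field.
Qed.

Lemma gaussian_tail B (l : R) : measurable B ->
  (forall p, B p -> l ^+ 2 <= p.1 ^+ 2 + p.2 ^+ 2) ->
  (P ((@plane R \o Z) @^-1` B) <= (2 * expR (- (l ^+ 2 / 2)))%:E)%E.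
Proof.
move=> mB H; rewrite gaussian_law //.
set c := 2 * _; have c0 : 0 <= c by rewrite mulr_ge0 // expR_ge0.
pose f (p : R * R) := (c * (normal_pdf 0 1 p.1 * normal_pdf 0 1 p.2))%:E.
have mf D : measurable_fun D f.
  apply: measurable_funTS; apply/measurable_EFinP; apply: measurable_funM; first exact: measurable_cst.
  by apply: measurable_funM; apply: measurableT_comp => //; exact: measurable_normal_pdf.
have f0 p : (0 <= f p)%E by rewrite lee_fin !mulr_ge0 // normal_pdf_ge0.
apply: (@le_trans _ _ (\int[leb2]_(p in B) f p)%E).
  apply: ge0_le_integral => //.
  - by move=> p _; rewrite lee_fin plane_pdf_ge0.
  - by apply/measurable_EFinP; exact: measurable_plane_pdf.
  - exact: mf.
  - move=> p Bp; rewrite lee_fin plane_pdf_normal.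
    rewrite ler_wpM2r ?mulr_ge0 ?normal_pdf_ge0 // ler_wpM2l // ler_expR lerN2.
    by rewrite ler_wpM2r // H.
apply: (@le_trans _ _ (\int[leb2]_p f p)%E).
  by apply: ge0_subset_integral => //; exact: mf.
rewrite /f; under eq_integral do rewrite EFinM.
rewrite ge0_integralZl //=.
- by rewrite integral_normal_pdf2 mule1.
- apply/measurable_EFinP; apply: measurable_funM; apply: measurableT_comp => //;
  exact: measurable_normal_pdf.
- by move=> p _; rewrite lee_fin mulr_ge0 // normal_pdf_ge0.
Qed.

End Gaussian.

(** * Tonelli for two independent random variables *)

Section Independence.
Variables (R : realType) (d d1 d2 : measure_display) (T : measurableType d)
  (S1 : measurableType d1) (S2 : measurableType d2) (P : probability T R).
Variables (X : {mfun T >-> S1}) (Y : {mfun T >-> S2}).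
Hypothesis XY : forall A B, measurable A -> measurable B ->
  P (X @^-1` A `&` Y @^-1` B) = (P (X @^-1` A) * P (Y @^-1` B))%E.

Let XY_pair t := (X t, Y t).

Let measurable_XY_pair : measurable_fun setT XY_pair.
Proof. by apply: measurable_fun_pair; exact: measurable_funPT. Qed.

HB.instance Definition _ := isMeasurableFun.Build _ _ _ _ XY_pair measurable_XY_pair.

Lemma independent_joint_law W : measurable W ->
  P (XY_pair @^-1` W) = (distribution P X \x distribution P Y)%E W.
Proof.
move=> mW; rewrite (product_measure_unique (m' := distribution P XY_pair)) //.
Qed.

(** Plays the part of a conditional probability bound: the joint law is a product measure, and each
    section over A contributes at most e. *)
Lemma independent_section_bound W A (e : R) : measurable W -> measurable A -> 0 <= e ->
  (forall x, (P (Y @^-1` (xsection W x)) <= e%:E)%E) ->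
  (P (X @^-1` A `&` [set t | W (X t, Y t)]) <= e%:E * P (X @^-1` A))%E.
Proof.
move=> mW mA e0 H.
have mW' : measurable (W `&` (A `*` setT)) by apply: measurableI => //; exact: measurableX.
have -> : X @^-1` A `&` [set t | W (X t, Y t)] = XY_pair @^-1` (W `&` (A `*` setT)).
  by apply/seteqP; split => t /= [h1 h2]; split => //; case: h2.
rewrite independent_joint_law // /product_measure1.
apply: (@le_trans _ _ (\int[distribution P X]_x (e%:E * (\1_A x)%:E))%E).
  apply: ge0_le_integral => //=.
  - exact: measurable_fun_xsection.
  - apply: measurable_funeM; apply/measurable_EFinP; exact: measurable_indic.
  - move=> x _; have [xA|xA] := boolP (x \in A).
      rewrite indicE xA mule1; apply: le_trans (H x).
      apply: le_measure.
      + by apply/mem_set; exact: measurable_xsection.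
      + by apply/mem_set; exact: measurable_xsection.
      + by move=> t; rewrite /xsection /= !inE => -[].
    rewrite indicE (negPf xA) mule0 (_ : xsection _ _ = set0) ?measure0 //.
    apply/seteqP; split => // y; rewrite /xsection /= inE => -[_ [] /= /mem_set].
    by rewrite (negPf xA).
rewrite ge0_integralZl //=; last first.
  by apply/measurable_EFinP; exact: measurable_indic.
by rewrite integral_indic // setIT.
Qed.

End Independence.

(** * Measurability of complex functions and of the hole event *)

Section ComplexMeasurable.
Variables (R : realType) (d : measure_display) (T : measurableType d).
Implicit Types (f g : T -> R[i]).

Definition cmeasurable f := measurable_fun [set: T] (@plane R \o f).

Lemma cmeasurableP f : cmeasurable f <->
  measurable_fun setT (fun t => complex.Re (f t)) /\ measurable_fun setT (fun t => complex.Im (f t)).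
Proof. by rewrite /cmeasurable measurable_fun_pairP. Qed.

Lemma cmeasurable_cst (c : R[i]) : cmeasurable (fun=> c).
Proof. exact: measurable_cst. Qed.

Lemma cmeasurableD f g : cmeasurable f -> cmeasurable g -> cmeasurable (fun t => f t + g t).
Proof.
move=> /cmeasurableP[fr fi] /cmeasurableP[gr gi]; apply/cmeasurableP; split.
  by under eq_fun do rewrite ReD; exact: measurable_funD.
by under eq_fun do rewrite ImD; exact: measurable_funD.
Qed.

Lemma cmeasurableM f g : cmeasurable f -> cmeasurable g -> cmeasurable (fun t => f t * g t).
Proof.
move=> /cmeasurableP[fr fi] /cmeasurableP[gr gi]; apply/cmeasurableP; split.
  by under eq_fun do rewrite ReM; apply: measurable_funB; exact: measurable_funM.
by under eq_fun do rewrite ImM; apply: measurable_funD; exact: measurable_funM.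
Qed.

Lemma cmeasurableN f : cmeasurable f -> cmeasurable (fun t => - f t).
Proof.
move=> mf; under eq_fun do rewrite -mulN1r.
by apply: cmeasurableM => //; exact: cmeasurable_cst.
Qed.

Lemma cmeasurableV f : cmeasurable f -> cmeasurable (fun t => (f t)^-1).
Proof.
move=> /cmeasurableP[fr fi].
have mq : measurable_fun setT (fun t => (complex.Re (f t) ^+ 2 + complex.Im (f t) ^+ 2)^-1).
  (* Measurability of the inverse comes from that of the real power; at 0 both sides are 0. *)
  have E t : (complex.Re (f t) ^+ 2 + complex.Im (f t) ^+ 2)^-1 =
      (complex.Re (f t) ^+ 2 + complex.Im (f t) ^+ 2) `^ (-1).
    by rewrite powR_inv1 // addr_ge0 // sqr_ge0.
  under eq_fun do rewrite E.
  have mn : measurable_fun setT (fun t => complex.Re (f t) ^+ 2 + complex.Im (f t) ^+ 2).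
    by apply: measurable_funD; exact: measurable_funX.
  exact: (measurableT_comp (measurable_powR (-1)) mn).
apply/cmeasurableP; split.
  have E t : complex.Re (f t)^-1 = complex.Re (f t) * (complex.Re (f t) ^+ 2 + complex.Im (f t) ^+ 2)^-1.
    by case: (f t).
  by under eq_fun do rewrite E; exact: measurable_funM.
have E t : complex.Im (f t)^-1 = - complex.Im (f t) * (complex.Re (f t) ^+ 2 + complex.Im (f t) ^+ 2)^-1.
  by case: (f t) => a b /=; rewrite mulNr.
by under eq_fun do rewrite E; apply: measurable_funM => //; exact: measurable_funN.
Qed.

Lemma cmeasurable_sum (I : Type) (s : seq I) (F : I -> T -> R[i]) :
  (forall i, cmeasurable (F i)) -> cmeasurable (fun t => \sum_(i <- s) F i t).
Proof.
move=> H; elim: s => [|i s IH].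
  by under eq_fun do rewrite big_nil; exact: cmeasurable_cst.
by under eq_fun do rewrite big_cons; exact: cmeasurableD.
Qed.

Lemma measurable_nm f : cmeasurable f -> measurable_fun setT (fun t => nm (f t)).
Proof.
move=> /cmeasurableP[fr fi].
have E t : nm (f t) = Num.sqrt (complex.Re (f t) ^+ 2 + complex.Im (f t) ^+ 2).
  by rewrite /nm normc_def.
under eq_fun do rewrite E.
have mn : measurable_fun setT (fun t => complex.Re (f t) ^+ 2 + complex.Im (f t) ^+ 2).
  by apply: measurable_funD; exact: measurable_funX.
exact: (measurableT_comp (continuous_measurable_fun (@sqrt_continuous R)) mn).
Qed.

Lemma cmeasurable_power_sums (a : nat -> T -> R[i]) n j :
  (forall k, (k <= n)%N -> cmeasurable (a k)) ->
  cmeasurable (fun t => (power_sums (a ^~ t) n)`_j).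
Proof.
elim: n j => [|n IH] j H.
  by under eq_fun do rewrite /= nth_nil; exact: cmeasurable_cst.
have H' k : (k <= n)%N -> cmeasurable (a k) by move=> kn; apply: H; rewrite leqW.
under eq_fun do rewrite /= nth_rcons size_power_sums.
case: (ltnP j n) => jn; first exact: IH.
case: (j == n); last exact: cmeasurable_cst.
apply: cmeasurableM; first by apply/cmeasurableN/cmeasurableV/H.
apply: cmeasurableD; first by apply: cmeasurableM; [exact: cmeasurable_cst|exact: H].
apply: cmeasurable_sum => i; apply: cmeasurableM; first exact: IH.
by apply: H'; rewrite leq_subr.
Qed.

Lemma cmeasurable_next_coef (a : nat -> T -> R[i]) n :
  (forall k, (k <= n)%N -> cmeasurable (a k)) ->
  cmeasurable (fun t => next_coef (a ^~ t) n).
Proof.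
move=> H; apply: cmeasurableM; first exact: cmeasurable_cst.
apply: cmeasurable_sum => i; apply: cmeasurableM; first exact: cmeasurable_power_sums.
by apply: H; rewrite leq_subr.
Qed.

Section HoleEvent.
Variable zeta : nat -> T -> R[i].
Hypothesis mzeta : forall k, cmeasurable (zeta k).

Lemma measurable_entire_growth : measurable [set t | entire_growth (zeta ^~ t)].
Proof.
have -> : [set t | entire_growth (zeta ^~ t)] =
  \bigcap_m \bigcup_C \bigcap_k [set t | nm (zeta k t) * (m%:R ^+ k / sqrt_fact R k) <= C%:R].
  apply/seteqP; split => t /= H.
    by move=> m _; have [C HC] := H m; exists C => // k _; exact: HC.
  by move=> m; have [C _ HC] := H m I; exists C => k; exact: (HC k I).
apply: bigcapT_measurable => m; apply: bigcupT_measurable => C.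
apply: bigcapT_measurable => k.
rewrite -[X in measurable X]setTI.
apply: measurable_fun_ler => //.
by apply: measurable_funM => //; exact: measurable_nm.
Qed.

Lemma cmeasurable_gef_partial_sums z n :
  cmeasurable (fun t => gef_partial_sums (zeta ^~ t) z n).
Proof.
under eq_fun do rewrite gef_partial_sumsE.
by apply: cmeasurable_sum => k; apply: cmeasurableM => //; exact: cmeasurable_cst.
Qed.

Lemma hole_eventE (r : R) : 0 < r -> hole_event zeta r =
  [set t | entire_growth (zeta ^~ t)] `&`
  [set t | exists q n0, uniformly_nonvanishing (zeta ^~ t) r q n0].
Proof.
move=> r0; apply/seteqP; split => t /=.
  move=> [cv nv]; have G := entire_growth_of_cvg cv; split => //.
  by apply/(gef_nonvanishingP G r0) => z zr; apply: nv; rewrite normC_nm lecR.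
move=> [G U]; split => [z|z]; first exact: gef_cvg.
by rewrite normC_nm lecR; move: z; apply/(gef_nonvanishingP G r0).
Qed.

Lemma measurable_hole_event (r : R) : 0 < r -> measurable (hole_event zeta r).
Proof.
move=> r0; rewrite hole_eventE //; apply: measurableI; first exact: measurable_entire_growth.
have -> : [set t | exists q n0, uniformly_nonvanishing (zeta ^~ t) r q n0] =
  \bigcup_q \bigcup_n0 \bigcap_n \bigcap_i
    (* Pairs of rationals are enumerated by their codes i; a code of no pair imposes nothing. *)
    [set t | if (choice.unpickle i : option (rat * rat)) is Some p then
      (n0 <= n)%N -> nm (rat_point R p) <= r ->
      q.+1%:R^-1 <= nm (gef_partial_sums (zeta ^~ t) (rat_point R p) n) else True].
  apply/seteqP; split => t /=.
    move=> [q [n0 H]]; exists q => //; exists n0 => // n _ i _ /=.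
    by case: choice.unpickle => // p; exact: H.
  move=> [q _ [n0 _ H]]; exists q, n0 => n p.
  move: (H n I (choice.pickle p) I) => Hp.
  by rewrite /mkset choice.pickleK in Hp.
apply: bigcupT_measurable => q; apply: bigcupT_measurable => n0.
apply: bigcapT_measurable => n; apply: bigcapT_measurable => i.
case: choice.unpickle => [p|]; last by rewrite (_ : [set _ | True] = setT) //; apply/seteqP.
case: (leqP n0 n) => [nn0|nn0]; last first.
  by rewrite (_ : [set _ | _] = setT) //; apply/seteqP; split => // t _ /=.
case: (boolP (nm (rat_point R p) <= r)) => [pr|pr]; last first.
  by rewrite (_ : [set _ | _] = setT) //; apply/seteqP; split => // t _ /=.
rewrite (_ : [set _ | _] = [set t | q.+1%:R^-1 <= nm (gef_partial_sums (zeta ^~ t) (rat_point R p) n)]).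
  rewrite -[X in measurable X]setTI; apply: measurable_fun_ler => //.
  exact/measurable_nm/cmeasurable_gef_partial_sums.
by apply/seteqP; split => t /=; [apply|move=> ?].
Qed.

End HoleEvent.
End ComplexMeasurable.

(** * The past of the sequence and its independence from the next term *)

Section History.
Variables (R : realType) (d : measure_display) (T : measurableType d)
  (P : probability T R) (zeta : nat -> T -> R[i]).
Hypothesis mzeta : forall k, cmeasurable (zeta k).
Hypothesis indep : independent_sequence P zeta.
Implicit Types (B : nat -> set (R * R)) (k : nat).

Definition cylinder B k : set T := \bigcap_(j in `I_k) ((@plane R \o zeta j) @^-1` B j).

Lemma measurable_preimage k C : measurable C -> measurable ((@plane R \o zeta k) @^-1` C).
Proof. by move=> mC; rewrite -[X in measurable X]setTI; exact: mzeta. Qed.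

Lemma measurable_cylinder B k : (forall j, measurable (B j)) -> measurable (cylinder B k).
Proof. by move=> mB; apply: fin_bigcap_measurable => // j _; exact: measurable_preimage. Qed.

Lemma cylinderS B k : cylinder B k.+1 = cylinder B k `&` ((@plane R \o zeta k) @^-1` B k).
Proof.
apply/seteqP; split => t /=.
  by move=> H; split; [move=> j jk; apply: H; rewrite /= ltnS ltnW|apply: H => /=].
by move=> [H1 H2] j /=; rewrite ltnS leq_eqVlt => /orP[/eqP ->//|/H1].
Qed.

Let initial k : {fset nat} := [fset j in iota 0 k]%fset.

Let mem_initial k j : (j \in initial k) = (j < k)%N.
Proof. by rewrite inE /= mem_iota add0n. Qed.

Let initialE k : [set` initial k] = `I_k.
Proof. by apply/seteqP; split => j; rewrite /= mem_initial. Qed.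

Lemma cylinder_prob B k : (forall j, measurable (B j)) ->
  P (cylinder B k) = (\prod_(j <- initial k) P ((@plane R \o zeta j) @^-1` B j))%E.
Proof. by move=> mB; rewrite /cylinder -initialE indep. Qed.

Lemma cylinder_prob_step B k : (forall j, measurable (B j)) ->
  P (cylinder B k.+1) = (P (cylinder B k) * P ((@plane R \o zeta k) @^-1` B k))%E.
Proof.
move=> mB; rewrite !cylinder_prob //.
have -> : initial k.+1 = (k |` initial k)%fset.
  by apply/fsetP => j; rewrite mem_initial in_fset1U mem_initial ltnS leq_eqVlt.
rewrite big_fsetU1 /= 1?muleC //.
by rewrite mem_initial ltnn.
Qed.

(* The past is a sigma-algebra on T itself, which avoids products of k planes. *)
Definition history k : set (set T) :=
  [set A | exists2 B, (forall j, measurable (B j)) & A = cylinder B k].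

Lemma history_setI k : setI_closed (history k).
Proof.
move=> A A' [B mB ->] [B' mB' ->]; exists (fun j => B j `&` B' j).
  by move=> j; apply: measurableI.
apply/seteqP; split => t /=.
  by move=> [H H'] j jk; split; [exact: H|exact: H'].
by move=> H; split => j jk; have [] := H j jk.
Qed.

Lemma history_measurable k : history k `<=` measurable.
Proof. by move=> A [B mB ->]; exact: measurable_cylinder. Qed.

Lemma sigma_history_measurable k : <<s history k >> `<=` measurable.
Proof. by apply: smallest_sub; [exact: sigma_algebra_measurable|exact: history_measurable]. Qed.

Lemma history_setT k : history k setT.
Proof. by exists (fun=> setT) => //; apply/seteqP; split. Qed.

Lemma history_independent k A C : <<s history k >> A -> measurable C ->
  P (A `&` (@plane R \o zeta k) @^-1` C) = (P A * P ((@plane R \o zeta k) @^-1` C))%E.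
Proof.
move=> sA mC; set E := _ @^-1` C.
have mE : measurable E by exact: measurable_preimage.
have PE : P E \is a fin_num by exact: fin_num_measure.
have PE0 : 0 <= fine (P E) by exact: fine_ge0.
(* Uniqueness of measures on a pi-system: A -> P (A & E) and A -> P E * P A agree on cylinders,
   hence on the sigma-algebra that they generate. *)
pose m1 := mrestr P mE; pose m2 := mscale (NngNum PE0) P.
suff -> : P (A `&` E) = m2 A by rewrite /m2 /mscale /= fineK // muleC.
rewrite -[LHS]/(m1 A).
apply: (@g_sigma_algebra_measure_unique _ _ _ (history k) _ (fun=> setT)) => //.
- exact: history_measurable.
- by move=> _; exact: history_setT.
- by rewrite bigcup_const //; exists 0%N.
- exact: history_setI.
- move=> _ [B mB ->]; change (P (cylinder B k `&` E) = (fine (P E))%:E * P (cylinder B k))%E.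
  rewrite fineK // muleC.
  (* A cylinder of length k ignores slot k, so C can be stored there and the event read as a
     cylinder of length k + 1. *)
  pose B' j := if j == k then C else B j.
  have mB' j : measurable (B' j) by rewrite /B'; case: ifP.
  have <- : cylinder B' k = cylinder B k.
    by apply: eq_bigcapr => j /= jk; rewrite /B' ltn_eqF.
  by have := cylinder_prob_step k mB'; rewrite cylinderS /B' eqxx.
- by move=> _; rewrite /m1 /mrestr /= (le_lt_trans (probability_le1 _ _)) ?ltry //; exact: measurableI.
Qed.

Local Notation past k := (g_sigma_algebraType (history k)).

Lemma past_cmeasurable k j : (j < k)%N -> cmeasurable (zeta j : past k -> R[i]).
Proof.
move=> jk _ C mC; rewrite setTI; apply: sub_sigma_algebra.
exists (fun i => if i == j then C else setT).
  by move=> i; case: ifP.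
apply/seteqP; split => t /=; last by move/(_ j jk); rewrite eqxx.
by move=> H i ik; case: eqP => // ->.
Qed.

(** The identity into T with the coarser sigma-algebra: it makes the whole past a single random
    variable. *)
Definition to_past k (t : T) : past k := t.
Definition coordinate k (t : T) : R * R := plane (zeta k t).

Lemma measurable_to_past k : measurable_fun setT (@to_past k).
Proof. by move=> _ A mA; rewrite setTI; exact: (@sigma_history_measurable k A mA). Qed.

Lemma measurable_coordinate k : measurable_fun setT (@coordinate k).
Proof. exact: mzeta. Qed.

HB.instance Definition _ k := isMeasurableFun.Build _ _ _ _ (@to_past k) (@measurable_to_past k).
HB.instance Definition _ k := isMeasurableFun.Build _ _ _ _ (@coordinate k) (@measurable_coordinate k).

Lemma history_section_bound k (W : set (past k * (R * R))) A (e : R) : measurable W ->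
  <<s history k >> A -> 0 <= e ->
  (forall x, (P ((@plane R \o zeta k) @^-1` (xsection W x)) <= e%:E)%E) ->
  (P (A `&` [set t | W (t, plane (zeta k t))]) <= e%:E * P A)%E.
Proof.
move=> mW sA e0 H.
have indepXY A' C : measurable A' -> measurable C ->
    P (@to_past k @^-1` A' `&` @coordinate k @^-1` C) =
    (P (@to_past k @^-1` A') * P (@coordinate k @^-1` C))%E.
  by move=> sA' mC; exact: history_independent.
exact: (independent_section_bound indepXY mW sA e0 H).
Qed.

End History.

(** * Successive confinement of the coefficients *)

Section Confinement.
Variables (R : realType) (r : R).
Hypothesis r1 : 1 <= r.

Let r0 : 0 < r. Proof. by apply: lt_le_trans r1. Qed.

(* 22 r^4 bounds 2 |a_0| (B - ln |a_0|) when |a_0| <= r^2 and B = 10 r^2. *)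
Definition coef_window k : R := 22 * r ^+ 4 * (sqrt_fact R k / r ^+ k).

Lemma coef_window_ge0 k : 0 <= coef_window k.
Proof. by rewrite !mulr_ge0 ?exprn_ge0 ?invr_ge0 ?exprn_ge0 ?(ltW r0) // ltW // sqrt_fact_gt0. Qed.

Definition predicted_coef (a : nat -> R[i]) k : R[i] :=
  (sqrt_fact R k.+1 / r ^+ k.+1)%:C * next_coef (scaled_coef a r) k.

(** A square rather than a disk, so that its area is a product of interval lengths. *)
Definition confined (w z : R[i]) (e : R) :=
  `|complex.Re z - complex.Re w| <= e /\ `|complex.Im z - complex.Im w| <= e.

Lemma confined_of_estimate a k :
  nm (scaled_coef a r k.+1 - next_coef (scaled_coef a r) k) <= 22 * r ^+ 4 ->
  confined (predicted_coef a k) (a k.+1) (coef_window k.+1).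
Proof.
set c := sqrt_fact R k.+1 / r ^+ k.+1.
have c0 : 0 < c by rewrite divr_gt0 ?exprn_gt0 // sqrt_fact_gt0.
move=> H; have h : nm (a k.+1 - predicted_coef a k) <= coef_window k.+1.
  have -> : a k.+1 - predicted_coef a k =
     c%:C * (scaled_coef a r k.+1 - next_coef (scaled_coef a r) k).
    rewrite mulrBr /scaled_coef; congr (_ - _).
    rewrite mulrCA -(rmorphM (real_complex R)).
    rewrite (_ : c * (r ^+ k.+1 / sqrt_fact R k.+1) = 1) ?mulr1 //.
    by rewrite /c mulrA divfK ?mulfV // gt_eqF ?exprn_gt0 ?sqrt_fact_gt0.
  by rewrite nmM nm_real gtr0_norm // mulrC /coef_window ler_wpM2r // ltW.
by split; [rewrite -ReN -ReD (le_trans (le_Re_nm _))|rewrite -ImN -ImD (le_trans (le_Im_nm _))].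
Qed.

Section Measurable.
Variables (d : measure_display) (S : measurableType d) (zeta : nat -> S -> R[i]).

Lemma cmeasurable_predicted_coef k : (forall j, (j <= k)%N -> cmeasurable (zeta j)) ->
  cmeasurable (fun t => predicted_coef (zeta ^~ t) k).
Proof.
move=> mz; apply: cmeasurableM; first exact: cmeasurable_cst.
apply: (@cmeasurable_next_coef _ _ _ (fun j t => scaled_coef (zeta ^~ t) r j)) => j jk.
by apply: cmeasurableM; [exact: mz|exact: cmeasurable_cst].
Qed.

Lemma measurable_confined (f g : S -> R[i]) (e : R) : cmeasurable f -> cmeasurable g ->
  measurable [set t | confined (f t) (g t) e].
Proof.
move=> /cmeasurableP[fr fi] /cmeasurableP[gr gi]; apply: measurableI.
  rewrite -[X in measurable X]setTI; apply: measurable_fun_ler => //.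
  by apply: measurableT_comp => //; exact: measurable_funB.
rewrite -[X in measurable X]setTI; apply: measurable_fun_ler => //.
by apply: measurableT_comp => //; exact: measurable_funB.
Qed.

End Measurable.

Section Sequential.
Variables (d : measure_display) (T : measurableType d)
  (P : probability T R) (zeta : nat -> T -> R[i]).
Hypothesis gauss : forall k, standard_complex_gaussian P (zeta k).
Hypothesis indep : independent_sequence P zeta.
Let mzeta k : cmeasurable (zeta k) := (gauss k).1.

Definition confined_between n0 m : set T :=
  [set t | forall k, (n0 <= k < m)%N ->
    confined (predicted_coef (zeta ^~ t) k) (zeta k.+1 t) (coef_window k.+1)].

Lemma confined_betweenS n0 m : (n0 <= m)%N -> confined_between n0 m.+1 =
  confined_between n0 m `&`
  [set t | confined (predicted_coef (zeta ^~ t) m) (zeta m.+1 t) (coef_window m.+1)].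
Proof.
move=> n0m; apply/seteqP; split => t /=.
  move=> H; split; last by apply: H; rewrite n0m ltnS /=.
  by move=> k /andP[n0k km]; apply: H; rewrite n0k ltnS ltnW.
move=> [H1 H2] k /andP[n0k]; rewrite ltnS leq_eqVlt => /orP[/eqP ->//|km].
by apply: H1; rewrite n0k.
Qed.

(** For k < m the condition reads zeta_0, ..., zeta_m only, which makes the event independent of
    zeta_(m+1), the variable confined next. *)
Lemma confined_between_past n0 m : <<s history zeta m.+1 >> (confined_between n0 m).
Proof.
have -> : confined_between n0 m = \bigcap_(k in [set k | (n0 <= k < m)%N])
   [set t | confined (predicted_coef (zeta ^~ t) k) (zeta k.+1 t) (coef_window k.+1)].
  by apply/seteqP; split.
apply: (@fin_bigcap_measurable _ (g_sigma_algebraType (history zeta m.+1))).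
  by apply: (sub_finite_set _ (finite_II m)) => k /= /andP[].
move=> k /= /andP[_ km].
apply: (@measurable_confined _ (g_sigma_algebraType (history zeta m.+1))
  (fun t => predicted_coef (zeta ^~ t) k) (zeta k.+1)).
  apply: (@cmeasurable_predicted_coef _ (g_sigma_algebraType (history zeta m.+1)) zeta) => j jk.
  by apply: past_cmeasurable; lia.
by apply: past_cmeasurable; lia.
Qed.

Lemma measurable_confined_between n0 m : measurable (confined_between n0 m).
Proof. exact: (sigma_history_measurable mzeta (@confined_between_past n0 m)). Qed.

(** With the past frozen, zeta_(m+1) must fall in a fixed square of side 2 [coef_window], and the
    Gaussian density is at most 1. *)
Lemma confined_between_step n0 m : (n0 <= m)%N ->
  (P (confined_between n0 m.+1) <=
    ((2 * coef_window m.+1) ^+ 2)%:E * P (confined_between n0 m))%E.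
Proof.
move=> n0m; rewrite confined_betweenS //.
pose S := g_sigma_algebraType (history zeta m.+1).
pose W : set (S * (R * R)) := [set x |
  confined (predicted_coef (zeta ^~ x.1) m) (x.2.1 +i* x.2.2) (coef_window m.+1)].
have mp : cmeasurable (fun t : S => predicted_coef (zeta ^~ t) m).
  apply: (@cmeasurable_predicted_coef _ S zeta) => j jm.
  by apply: past_cmeasurable; lia.
have mW : measurable W.
  apply: (@measurable_confined _ (S * (R * R))%type (fun x => predicted_coef (zeta ^~ x.1) m)
     (fun x => x.2.1 +i* x.2.2)).
    exact: (measurableT_comp mp (@measurable_fst _ _ _ _)).
  apply/cmeasurableP; split => /=.
    exact: (measurableT_comp (@measurable_fst _ _ _ _) (@measurable_snd _ _ _ _)).
  exact: (measurableT_comp (@measurable_snd _ _ _ _) (@measurable_snd _ _ _ _)).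
have -> : [set t | confined (predicted_coef (zeta ^~ t) m) (zeta m.+1 t) (coef_window m.+1)] =
   [set t | W (t, plane (zeta m.+1 t))].
  by apply/seteqP; split => t /=; rewrite /W /=; case: (zeta m.+1 t).
apply: (history_section_bound mzeta indep mW (@confined_between_past n0 m)).
  by rewrite sqr_ge0.
move=> x; set w := predicted_coef (zeta ^~ x) m.
apply: (@gaussian_box_le _ _ _ _ _ (gauss m.+1) _
  (complex.Re w - coef_window m.+1) (complex.Im w - coef_window m.+1)).
- by rewrite mulr_ge0 // coef_window_ge0.
- exact: measurable_xsection.
- move=> p /xsectionP; rewrite /W /confined /= -/w !ler_norml => -[/andP[h1 h2] /andP[h3 h4]].
  by split; rewrite /= in_itv /=; lra.
Qed.

Lemma confined_between_le n0 m : (n0 <= m)%N ->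
  (P (confined_between n0 m) <= (\prod_(n0 <= k < m) (2 * coef_window k.+1) ^+ 2)%:E)%E.
Proof.
move=> n0m; rewrite -(subnKC n0m); elim: (m - n0)%N => [|k IH].
  rewrite addn0 big_geq //; apply: probability_le1; exact: measurable_confined_between.
rewrite addnS big_nat_recr ?leq_addr //= mulrC EFinM.
apply: le_trans (confined_between_step (leq_addr _ _)) _.
by rewrite lee_wpmul2l // lee_fin sqr_ge0.
Qed.

End Sequential.
End Confinement.

(** * Exceptionally large coefficients *)

Lemma expR_opp_nat_le (R : realType) k : expR (- k%:R) <= 2^-1 ^+ k :> R.
Proof.
rewrite -mulN1r expRM_natr expRN lerXn2r ?nnegrE ?invr_ge0 ?expR_ge0 //.
by rewrite lef_pV2 ?posrE ?expR_gt0 // (le_trans _ (expR_ge1Dx _)).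
Qed.

Section UpperBound.
Variables (R : realType) (r : R).
Variables (d : measure_display) (T : measurableType d)
  (P : probability T R) (zeta : nat -> T -> R[i]).
Hypothesis gauss : forall k, standard_complex_gaussian P (zeta k).
Hypothesis indep : independent_sequence P zeta.
Let mzeta k : cmeasurable (zeta k) := (gauss k).1.

Lemma nm_plane (z : R[i]) : nm z ^+ 2 = (plane z).1 ^+ 2 + (plane z).2 ^+ 2.
Proof. exact: nm2. Qed.

Lemma nm_tail k (l : R) : 0 <= l ->
  (P [set t | l < nm (zeta k t)]%R <= (2 * expR (- (l ^+ 2 / 2)))%:E)%E.
Proof.
move=> l0; pose B : set (R * R) := [set p | l ^+ 2 < p.1 ^+ 2 + p.2 ^+ 2].
have -> : [set t | l < nm (zeta k t)] = (@plane R \o zeta k) @^-1` B.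
  apply/seteqP; split => t /=; rewrite /B /= -nm_plane.
    by rewrite ltr_pXn2r ?nnegrE ?nm_ge0.
  by rewrite ltr_pXn2r ?nnegrE ?nm_ge0.
apply: (gaussian_tail (gauss k)) => [|p]; last by move/ltW.
rewrite -[X in measurable X]setTI; apply: measurable_fun_ltr => //.
by apply: measurable_funD; apply: measurable_funX; [exact: measurable_fst|exact: measurable_snd].
Qed.

Lemma measurable_nm_gt k (l : R) : measurable [set t | l < nm (zeta k t)].
Proof.
rewrite -[X in measurable X]setTI; apply: measurable_fun_ltr => //.
exact: measurable_nm.
Qed.

Lemma nneseries_geometric_le (f : nat -> \bar R) (C : R) : 0 <= C ->
  (forall k, (0 <= f k)%E) -> (forall k, (f k <= (C * 2^-1 ^+ k)%:E)%E) ->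
  (\sum_(k <oo) f k <= (2 * C)%:E)%E.
Proof.
move=> C0 f0 fC; apply: lime_le; first by apply: is_cvg_nneseries.
apply: nearW => n; apply: (@le_trans _ _ (\sum_(0 <= k < n) (C * 2^-1 ^+ k)%:E)%E).
  by apply: lee_sum => k _.
rewrite sumEFin lee_fin -mulr_sumr mulrC ler_wpM2r //.
have h := @sum_geometric_le R 2^-1 0 n; rewrite expr0 in h.
have e2 : 1 / (1 - 2^-1) = 2 :> R by field.
by rewrite -[leRHS]e2; apply: h => //; lra.
Qed.

(** Union bound: 4^k >= (k + 1)^2 >= 1 + 2 k turns exp (- r^4 4^k / 2) into exp (- r^4 / 2) times a
    summable exp (- k). *)
Lemma large_coefficient_event : 1 <= r ->
  (P (\bigcup_k [set t | (r ^+ 2 * 2 ^+ k < nm (zeta k t))%R]) <= (4 * expR (- (r ^+ 4 / 2)))%:E)%E.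
Proof.
move=> r1; have r0 : 0 <= r by lra.
have l0 k : 0 <= r ^+ 2 * 2 ^+ k by rewrite mulr_ge0 ?exprn_ge0.
apply: (le_trans (measure_sigma_subadditive _ _ _ (@subset_refl _ _))).
- by move=> k; exact: measurable_nm_gt.
- by apply: bigcupT_measurable => k; exact: measurable_nm_gt.
have -> : 4 * expR (- (r ^+ 4 / 2)) = 2 * (2 * expR (- (r ^+ 4 / 2))) by ring.
apply: nneseries_geometric_le => [|//|k]; first by rewrite mulr_ge0 // expR_ge0.
apply: (le_trans (nm_tail k (l0 k))); rewrite lee_fin -mulrA ler_wpM2l //.
apply: (le_trans _ (ler_wpM2l (expR_ge0 _) (expR_opp_nat_le R k))).
rewrite -expRD ler_expR -opprD lerN2.
have r4 : 1 <= r ^+ 4 by rewrite exprn_ege1.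
have k2 : k%:R + 1 <= 2 ^+ k :> R by rewrite natr1 -natrX ler_nat ltn_expl.
have k0 : 0 <= k%:R :> R by [].
have E : (r ^+ 2 * 2 ^+ k) ^+ 2 = r ^+ 4 * (2 ^+ k * 2 ^+ k) by ring.
have h1 : (k%:R + 1) * (k%:R + 1) <= 2 ^+ k * 2 ^+ k :> R by apply: ler_pM => //; lra.
have h2 : 1 + 2 * k%:R <= 2 ^+ k * 2 ^+ k :> R.
  by apply: le_trans h1; rewrite mulrDl mulrDr; have := mulr_ge0 k0 k0; lra.
have h3 : r ^+ 4 * (1 + 2 * k%:R) <= r ^+ 4 * (2 ^+ k * 2 ^+ k) by rewrite ler_wpM2l //; lra.
have h4 : k%:R <= r ^+ 4 * k%:R by rewrite -[leLHS]mul1r ler_wpM2r.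
rewrite E; move: h3 h4; rewrite mulrDr; lra.
Qed.

End UpperBound.

(** * The upper bound *)

Lemma fact_le_exp m k : (k <= m)%N -> (k`! <= m ^ k)%N.
Proof. by elim: k => // k IH km; rewrite factS expnS leq_mul // IH // ltnW. Qed.

(** At n = 64 the left side is 2^48, and each step multiplies it by at most (65/64)^4 < 2. *)
Lemma power4_le_exp2 (R : realType) n : (64 <= n)%N -> 2 ^+ 24 * n%:R ^+ 4 <= 2 ^+ n :> R.
Proof.
move=> n64; rewrite -(subnKC n64); elim: (n - 64)%N => [|k IH].
  rewrite addn0 (_ : 64%:R = 2 ^+ 6 :> R); last by ring.
  by rewrite -exprM -exprD; apply: ler_weXn2l => //; lra.
rewrite addnS exprS; apply: le_trans (ler_wpM2l _ IH); last by [].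
rewrite [leRHS]mulrCA ler_wpM2l ?exprn_ge0 //.
set x := (64 + k)%:R; rewrite -natr1 -/x.
have x64 : 64 <= x by rewrite /x natrD lerDl.
have h1 : x + 1 <= 65 / 64 * x by lra.
have h2 : (x + 1) ^+ 4 <= (65 / 64 * x) ^+ 4 by rewrite lerXn2r ?nnegrE //; lra.
apply: (le_trans h2); rewrite exprMn ler_wpM2r ?exprn_ge0 //.
by rewrite !exprS expr0; lra.
Qed.

Section UpperBound.
Variables (R : realType) (r : R).
Hypothesis r100 : 100 <= r.
Let r0 : 0 < r. Proof. by apply: lt_le_trans r100. Qed.
Let r1 : 1 <= r. Proof. by apply: le_trans r100; lra. Qed.
Let r2 : 10000 <= r ^+ 2.
Proof. by rewrite expr2; apply: le_trans (ler_pM _ _ r100 r100); lra. Qed.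

Variable n0 : nat.
Hypotheses (n0_le : n0%:R <= r ^+ 2 / 8) (n0_gt : r ^+ 2 / 8 < n0%:R + 1).

(** The constant 1936 = 44^2 comes from the squared side of the window. As r^8 <= 4096 (n0 + 1)^4,
    the factor 2^24 = 2 * 4096 * 2048 is enough. *)
Let n0_large : 1936 * r ^+ 8 <= 2 ^+ n0.
Proof.
have y64 : (64 <= n0.+1)%N.
  by rewrite -(ler_nat R) -[n0.+1%:R]natr1; move: n0_gt r2; set y : R := n0%:R; lra.
have := power4_le_exp2 R y64; rewrite -[n0.+1%:R]natr1 [2 ^+ n0.+1]exprS => h.
have h2 : r ^+ 2 <= 8 * (n0%:R + 1) by have := n0_gt; lra.
have h3 : (r ^+ 2) ^+ 4 <= (8 * (n0%:R + 1)) ^+ 4.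
  by rewrite lerXn2r ?nnegrE ?sqr_ge0 // mulr_ge0 // addr_ge0.
rewrite -exprM exprMn in h3.
have e8 : 8 ^+ 4 = 4096 :> R by rewrite !exprS expr0; lra.
have e12 : 2 ^+ 12 = 4096 :> R by rewrite !exprS expr0; lra.
rewrite e8 in h3; rewrite (exprD 2 12 12) e12 in h.
have y0 : 0 <= (n0%:R + 1 : R) ^+ 4 by rewrite exprn_ge0 // addr_ge0.
move: h3 h y0; rewrite (_ : 2 * 4 = 8)%N //; set y := (_ + 1) ^+ 4; set x := r ^+ 8; lra.
Qed.

(** From k + 1 <= 2 n0 <= r^2 / 4 follows (k+1)! <= (r^2 / 4)^(k+1); of the resulting 4^-n0, half
    the exponent pays for 1936 r^8. *)
Lemma coef_window_small k : (n0 <= k < n0 + n0)%N -> (2 * coef_window r k.+1) ^+ 2 <= 2^-1 ^+ n0.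
Proof.
move=> /andP[n0k kn0]; rewrite /coef_window.
have -> : (2 * (22 * r ^+ 4 * (sqrt_fact R k.+1 / r ^+ k.+1))) ^+ 2 =
   1936 * r ^+ 8 * (sqrt_fact R k.+1 ^+ 2 / (r ^+ k.+1) ^+ 2).
  by rewrite -(exprVn (r ^+ k.+1) 2); move: (r ^+ k.+1)^-1 (sqrt_fact R k.+1) => u s; ring.
rewrite sqr_sqrtr // -exprM mulnC exprM.
have kr : k.+1%:R <= r ^+ 2 / 4.
  apply: (@le_trans _ _ (n0 + n0)%:R); first by rewrite ler_nat.
  by rewrite natrD; have := n0_le; lra.
have r20 : 0 < r ^+ 2 by rewrite exprn_gt0.
have F : (k.+1)`!%:R / (r ^+ 2) ^+ k.+1 <= 4^-1 ^+ k.+1.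
  rewrite ler_pdivrMr ?exprn_gt0 // -exprMn mulrC.
  apply: (@le_trans _ _ (k.+1%:R ^+ k.+1)).
    by rewrite -natrX ler_nat fact_le_exp.
  by rewrite lerXn2r ?nnegrE // ?divr_ge0 ?(ltW r20).
have f0 : 0 <= (k.+1)`!%:R / (r ^+ 2) ^+ k.+1 by rewrite divr_ge0 // exprn_ge0 // ltW.
apply: (@le_trans _ _ (2 ^+ n0 * 4^-1 ^+ n0)).
  apply: ler_pM n0_large _; [|exact: f0|].
    by apply: mulr_ge0; [lra|rewrite exprn_ge0 // ltW].
  apply: (le_trans F); apply: ler_wiXn2l; [lra|lra|exact: leqW].
by rewrite -exprMn (_ : 2 * 4^-1 = 2^-1) //; field.
Qed.

Lemma half_pow_le n : 2^-1 ^+ n <= expR (- (n%:R / 2)) :> R.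
Proof.
have -> : - (n%:R / 2) = n%:R * (- 2^-1) :> R by rewrite mulrN.
rewrite expRM_natl lerXn2r ?nnegrE ?expR_ge0 //.
by apply: le_trans (expR_ge1Dx _); lra.
Qed.

Variables (d : measure_display) (T : measurableType d)
  (P : probability T R) (zeta : nat -> T -> R[i]).
Hypothesis gauss : forall k, standard_complex_gaussian P (zeta k).
Hypothesis indep : independent_sequence P zeta.
Let mzeta k : cmeasurable (zeta k) := (gauss k).1.

Lemma hole_event_sub : hole_event zeta r `<=`
  confined_between r zeta n0 (n0 + n0) `|` \bigcup_k [set t | (r ^+ 2 * 2 ^+ k < nm (zeta k t))%R].
Proof.
move=> t [cv nv]; have [H|H] := pselect (forall k, nm (zeta k t) <= r ^+ 2 * 2 ^+ k); last first.
  right; move/existsNP: H => [k /negP]; rewrite -ltNge => H; exists k => //.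
left => k _; apply: confined_of_estimate => //; apply: hole_coef_estimate => // z zr.
by apply: nv; rewrite normC_nm lecR.
Qed.

Lemma confined_between_small :
  (P (confined_between r zeta n0 (n0 + n0)) <= (expR (- (r ^+ 4 / 512)))%:E)%E.
Proof.
apply: (le_trans (confined_between_le r1 gauss indep (leq_addr n0 n0))); rewrite lee_fin.
apply: (@le_trans _ _ (\prod_(n0 <= k < n0 + n0) 2^-1 ^+ n0)).
  rewrite !big_nat; apply: ler_prod => k kn; rewrite sqr_ge0 /=.
  exact: coef_window_small.
rewrite prodr_const_nat addnK -exprM; apply: (le_trans (half_pow_le _)).
rewrite ler_expR lerN2 natrM.
have h : r ^+ 2 / 16 <= n0%:R by move: n0_gt r2; set y : R := n0%:R; lra.
have h2 : (r ^+ 2 / 16) * (r ^+ 2 / 16) <= n0%:R * n0%:R by apply: ler_pM => //; rewrite divr_ge0 // sqr_ge0.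
have E : (r ^+ 2 / 16) * (r ^+ 2 / 16) = r ^+ 4 / 256 by field.
rewrite E in h2; lra.
Qed.

Lemma hole_probability_le :
  (hole_probability P zeta r <= (expR (- (1024^-1 * r ^+ 4)))%:E)%E.
Proof.
have mC := measurable_confined_between r1 gauss n0 (n0 + n0).
have mB : measurable (\bigcup_k [set t | (r ^+ 2 * 2 ^+ k < nm (zeta k t))%R]).
  by apply: bigcupT_measurable => k; exact: measurable_nm_gt.
have r4 : 1 <= r ^+ 4 by rewrite exprn_ege1.
apply: (@le_trans _ _ (P (confined_between r zeta n0 (n0 + n0) `|`
    \bigcup_k [set t | (r ^+ 2 * 2 ^+ k < nm (zeta k t))%R]))).
  apply: le_measure; [|apply/mem_set; exact: measurableU|exact: hole_event_sub].
  by apply/mem_set; exact: measurable_hole_event.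
apply: (le_trans (measureU2 _ mC mB)).
apply: (le_trans (leeD confined_between_small (large_coefficient_event gauss r1))).
rewrite -EFinD lee_fin.
have h1 : expR (- (r ^+ 4 / 2)) <= expR (- (r ^+ 4 / 512)).
  by rewrite ler_expR lerN2; lra.
(* Two bounds with factors 1 and 4 are added; giving up half of the rate 1/512 absorbs the 5. *)
have h2 : 5 <= expR (r ^+ 4 / 1024).
  apply: le_trans (expR_ge1Dx _).
  have h : r ^+ 2 * 1 <= r ^+ 2 * r ^+ 2 by apply: ler_wpM2l; [exact: sqr_ge0|exact: exprn_ege1].
  by move: h r2; rewrite mulr1 -exprD -[(2 + 2)%N]/4%N; set x := r ^+ 2; set y := r ^+ 4; lra.
have -> : - (1024^-1 * r ^+ 4) = - (r ^+ 4 / 512) + r ^+ 4 / 1024 by field.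
rewrite expRD.
have := ler_wpM2l (expR_ge0 (- (r ^+ 4 / 512))) h2; lra.
Qed.

End UpperBound.

(** * The lower bound *)

Section LowerBound.
Variables (R : realType) (r : R) (n : nat).
Hypotheses (r1 : 1 <= r) (n_ge : 64 * r ^+ 2 * expR 1 <= n%:R).
Variables (d : measure_display) (T : measurableType d)
  (P : probability T R) (zeta : nat -> T -> R[i]).
Hypothesis gauss : forall k, standard_complex_gaussian P (zeta k).
Hypothesis indep : independent_sequence P zeta.
Let mzeta k : cmeasurable (zeta k) := (gauss k).1.
Let r0 : 0 <= r. Proof. by apply: le_trans r1. Qed.
Let r2 : 1 <= r ^+ 2. Proof. exact: exprn_ege1. Qed.

(** Halved because the modulus is estimated by |Re| + |Im|. *)
Definition small_side : R := expR (- (2 * r ^+ 2)) / 2.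

Let small_side_gt0 : 0 < small_side.
Proof. by rewrite divr_gt0 // expR_gt0. Qed.

Let small_side_le : 2 * small_side <= 1.
Proof.
rewrite /small_side mulrCA mulfV // mulr1 -[leRHS]expR0 ler_expR oppr_le0.
by rewrite mulr_ge0 // sqr_ge0.
Qed.

(* The constant coefficient dominates: Re zeta_0 >= 2, the next n coefficients are
   at most exp (- 2 r^2), and the others are at most 2^(k+1). *)
Definition hole_region k : set (R * R) :=
  if k == 0%N then box 2 0 1
  else if (k <= n)%N then box 0 0 small_side
  else [set p | p.1 ^+ 2 + p.2 ^+ 2 <= (2 * 2 ^+ k) ^+ 2].

(** Minus the logarithm of a lower bound for the probability of the k-th region. The summable 2^-k
    pays for the infinitely many late coefficients. *)
Definition hole_cost k : R := (if (k <= n)%N then 12 * r ^+ 2 else 0) + 2^-1 ^+ k.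

Lemma measurable_hole_region k : measurable (hole_region k).
Proof.
rewrite /hole_region; case: eqP => _; first exact: measurable_box.
case: ifP => _; first exact: measurable_box.
rewrite -[X in measurable X]setTI; apply: measurable_fun_ler => //.
by apply: measurable_funD; apply: measurable_funX; [exact: measurable_fst|exact: measurable_snd].
Qed.

Lemma expR2_ge4 : 4 <= expR 2 :> R.
Proof.
have h : 2 <= expR 1 :> R by apply: le_trans (expR_ge1Dx _); lra.
rewrite (_ : 2 = 1 + 1) // expRD; apply: le_trans (ler_pM _ _ h h); lra.
Qed.

Lemma plane_pdf_ge (p : R * R) (m : R) : p.1 ^+ 2 + p.2 ^+ 2 <= m -> expR (- (m + 2)) <= plane_pdf p.
Proof.
move=> pm; rewrite opprD addrC expRD; apply: ler_pM; rewrite ?expR_ge0 //; last by rewrite ler_expR lerN2.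
rewrite expRN lef_pV2 ?posrE ?expR_gt0 ?pi_gt0 //.
by apply: le_trans expR2_ge4; have := pihalf_lt2 R; lra.
Qed.

Lemma hole_region_prob k : ((expR (- hole_cost k))%:E <= P ((@plane R \o zeta k) @^-1` hole_region k))%E.
Proof.
rewrite /hole_region /hole_cost; have [->|k0] := eqVneq k 0%N.
  rewrite leq0n expr0.
  apply: (le_trans _ (gaussian_box_ge (gauss 0%N) (s := 1) (c := expR (- (10 + 2))) _ _ _)) => //.
  -  rewrite expr1n mulr1 lee_fin ler_expR lerN2. move: r2; set x := r ^+ 2. lra.
  - move=> p [] /=; rewrite !in_itv /= => /andP[p1 p2] /andP[p3 p4]; apply: plane_pdf_ge.
    have h1 : p.1 ^+ 2 <= 3 ^+ 2 by rewrite lerXn2r ?nnegrE //; lra.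
    have h2 : p.2 ^+ 2 <= 1 ^+ 2 by rewrite lerXn2r ?nnegrE //; lra.
    have e3 : 3 ^+ 2 = 9 :> R by ring.
    by rewrite e3 in h1; rewrite expr1n in h2; lra.
case: ifPn => kn.
  apply: (le_trans _ (gaussian_box_ge (gauss k) (s := small_side) (c := expR (- (2 + 2))) _ _ _)) => //.
  - have -> : expR (- (2 + 2)) * small_side ^+ 2 = expR (- (4 + 4 * r ^+ 2)) / 4.
      rewrite /small_side exprMn exprVn -expRM_natl mulrA -expRD.
      by congr (expR _ / _); ring.
    rewrite lee_fin ler_pdivlMr //.
    apply: (@le_trans _ _ (expR (- (12 * r ^+ 2)) * expR 2)).
      apply: ler_pM => //; rewrite ?expR_ge0 ?expR2_ge4 // ler_expR lerN2 lerDl exprn_ge0 //.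
    by rewrite -expRD ler_expR; move: r2; set x := r ^+ 2; lra.
  - exact: ltW.
  - move=> p [] /=; rewrite !in_itv /= !add0r => /andP[p1 p2] /andP[p3 p4]; apply: plane_pdf_ge.
    have s1 : small_side <= 1 by move: small_side_le small_side_gt0; set s := small_side; lra.
    have h1 : p.1 ^+ 2 <= 1 ^+ 2 by rewrite lerXn2r ?nnegrE // (le_trans p2 s1).
    have h2 : p.2 ^+ 2 <= 1 ^+ 2 by rewrite lerXn2r ?nnegrE // (le_trans p4 s1).
    by rewrite expr1n in h1 h2; lra.
rewrite add0r; set B := [set p | _ <= _]; pose l : R := 2 * 2 ^+ k.
have l0 : 0 <= l by rewrite mulr_ge0 // exprn_ge0.
pose x : R := 2 * expR (- (l ^+ 2 / 2)).
have tail : (P [set t | (l < nm (zeta k t))%R] <= x%:E)%E := nm_tail gauss k l0.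
have E : (@plane R \o zeta k) @^-1` B = ~` [set t | (l < nm (zeta k t))%R].
  apply/seteqP; split => t /=; rewrite /B /= -nm_plane.
    by rewrite ler_pXn2r ?nnegrE ?nm_ge0 // => h; apply/negP; rewrite -leNgt.
  by move/negP; rewrite -leNgt => h; rewrite ler_pXn2r ?nnegrE ?nm_ge0.
rewrite E probability_setC; last exact: measurable_nm_gt.
apply: (@le_trans _ _ (1 - x%:E)%E); last by rewrite leeB.
rewrite -EFinB lee_fin.
have xle : x <= 2 * 4^-1 ^+ k.+1.
  rewrite ler_wpM2l //; apply: (@le_trans _ _ (expR (k.+1%:R * - 2))).
    rewrite ler_expR mulrN lerN2 /l.
    have -> : (2 * 2 ^+ k) ^+ 2 / 2 = 2 ^+ k * (2 ^+ k * 2) :> R by field.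
    apply: ler_pM => //; first by rewrite -natrX ler_nat ltn_expl.
    by rewrite -[leLHS]mul1r ler_wpM2r // exprn_ege1 //; lra.
  rewrite expRM_natl lerXn2r ?nnegrE ?expR_ge0 ?invr_ge0 //.
  by rewrite expRN lef_pV2 ?posrE ?expR_gt0 // expR2_ge4.
have x12 : x <= 1 / 2.
  have : 4^-1 ^+ k.+1 <= 4^-1 ^+ 1 :> R by apply: ler_wiXn2l => //; lra.
  by rewrite expr1; lra.
have x2 : 2 * x <= 2^-1 ^+ k.
  apply: (@le_trans _ _ (4^-1 ^+ k)); first by move: xle; rewrite exprS; lra.
  by rewrite lerXn2r ?nnegrE //; lra.
have x0 : 0 <= x by rewrite mulr_ge0 // expR_ge0.
(* For 0 <= x <= 1/2, exp (- 2 x) <= 1 / (1 + 2 x) <= 1 - x. *)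
apply: (@le_trans _ _ (expR (- (2 * x)))); first by rewrite ler_expR lerN2.
have y0 : 0 < 1 + 2 * x by lra.
apply: (@le_trans _ _ (1 + 2 * x)^-1).
  by rewrite expRN lef_pV2 ?posrE ?expR_gt0 // expR_ge1Dx.
rewrite -[leLHS]mul1r ler_pdivrMr //.
have xx : x * x <= x * (1 / 2) by rewrite ler_wpM2l.
by rewrite mulrDr mulrDl; lra.
Qed.

Lemma cylinder_hole_region_prob N :
  ((expR (- \sum_(k < N) hole_cost k))%:E <= P (cylinder zeta hole_region N))%E.
Proof.
elim: N => [|N IH].
  rewrite big_ord0 oppr0 expR0 (_ : cylinder _ _ _ = setT) ?probability_setT //.
  by apply/seteqP; split.
rewrite (cylinder_prob_step indep) //; last exact: measurable_hole_region.
rewrite big_ord_recr /= opprD expRD EFinM.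
by apply: lee_pmul => //; rewrite ?lee_fin ?expR_ge0 // hole_region_prob.
Qed.

Lemma sum_hole_cost_le N : \sum_(k < N) hole_cost k <= 12 * r ^+ 2 * n.+1%:R + 2.
Proof.
rewrite /hole_cost big_split /= lerD //; last first.
  have h := @sum_geometric_le R 2^-1 0 N; rewrite expr0 big_mkord in h.
  have e2 : 1 / (1 - 2^-1) = 2 :> R by field.
  by rewrite -[leRHS]e2; apply: h => //; lra.
set c := 12 * r ^+ 2; have c0 : 0 <= c by rewrite mulr_ge0 // exprn_ge0.
have -> : \sum_(k < N) (if (k <= n)%N then c else 0) = c * (minn N n.+1)%:R.
  elim: N => [|N IH]; first by rewrite big_ord0 min0n mulr0.
  rewrite big_ord_recr /= IH minnSS; case: (leqP N n) => Nn.
    by rewrite (minn_idPl (leqW Nn)) -natr1 mulrDr mulr1.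
  by rewrite (minn_idPr Nn) addr0.
by rewrite ler_wpM2l // ler_nat geq_minr.
Qed.

(** The finite bounds are uniform in N, so they pass to the decreasing limit by continuity from
    above. *)
Lemma hole_region_prob_all :
  ((expR (- (12 * r ^+ 2 * n.+1%:R + 2)))%:E <= P (\bigcap_k cylinder zeta hole_region k))%E.
Proof.
have mc k : measurable (cylinder zeta hole_region k).
  by apply: measurable_cylinder => //; exact: measurable_hole_region.
have cv : P \o (cylinder zeta hole_region) @ \oo --> P (\bigcap_k cylinder zeta hole_region k).
  apply: nonincreasing_cvg_mu => //.
  - by rewrite (le_lt_trans (probability_le1 _ _)) // ltry.
  - exact: bigcapT_measurable.
  - move=> i j ij; apply/subsetPset => t H k /= ki; apply: H => /=; exact: leq_trans ki ij.
rewrite -(cvg_lim _ cv) //; apply: lime_ge; first by apply/cvg_ex; eexists; exact: cv.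
apply: nearW => N; apply: (le_trans _ (cylinder_hole_region_prob N)).
by rewrite lee_fin ler_expR lerN2 sum_hole_cost_le.
Qed.

Lemma hole_region_sub : \bigcap_k cylinder zeta hole_region k `<=` hole_event zeta r.
Proof.
move=> t H.
have Hk k : hole_region k (plane (zeta k t)) := H k.+1 I k (ltnSn k).
have Re0 : 2 <= complex.Re (zeta 0%N t) /\ nm (zeta 0%N t) <= 4.
  have := Hk 0%N; rewrite /hole_region eqxx /box /plane => -[] /=.
  rewrite !in_itv /= => /andP[h1 h2] /andP[h3 h4]; split => //.
  by apply: (le_trans (nm_le_ReIm _)); rewrite !ger0_norm //; lra.
have small k : (0 < k)%N -> (k <= n)%N -> nm (zeta k t) <= expR (- (2 * r ^+ 2)).
  move=> k0 kn; have := Hk k; rewrite /hole_region gtn_eqF // kn /box /plane => -[] /=.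
  rewrite !in_itv /= !add0r => /andP[h1 h2] /andP[h3 h4].
  apply: (le_trans (nm_le_ReIm _)); rewrite !ger0_norm //.
  have -> : expR (- (2 * r ^+ 2)) = small_side + small_side by rewrite /small_side; field.
  by rewrite lerD.
have large k : (n < k)%N -> nm (zeta k t) <= 2 * 2 ^+ k.
  move=> kn; have := Hk k; rewrite /hole_region gtn_eqF ?(leq_ltn_trans _ kn) //.
  by rewrite leqNgt kn /= -nm_plane ler_pXn2r ?nnegrE ?nm_ge0 //.
have p2 k : 1 <= 2 ^+ k :> R by rewrite exprn_ege1 //; lra.
have G : entire_growth (zeta ^~ t).
  apply: (entire_growth_of_le (C := 4)) => k.
  have [->|k0] := posnP k; first by rewrite expr0 mulr1; exact: Re0.2.
  case: (leqP k n) => kn; last by apply: (le_trans (large k kn)); rewrite ler_wpM2r ?exprn_ge0 //; lra.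
  apply: (le_trans (small k k0 kn)); apply: (@le_trans _ _ 1); last by have := p2 k; lra.
  by rewrite -[leRHS]expR0 ler_expR oppr_le0 mulr_ge0 // sqr_ge0.
split => [z|z]; first exact: gef_cvg.
rewrite normC_nm lecR; apply: hole_of_dominant_coef => //; last exact: Re0.1.
move=> k; case: (leqP k.+1 n) => kn; first by apply: head_coef_le => //; exact: small.
apply: tail_coef_le => //; last exact: large.
by apply: (le_trans n_ge); rewrite ler_nat ltnW.
Qed.

Lemma hole_probability_ge_cost :
  ((expR (- (12 * r ^+ 2 * n.+1%:R + 2)))%:E <= hole_probability P zeta r)%E.
Proof.
apply: (le_trans hole_region_prob_all); apply: le_measure; last exact: hole_region_sub.
  apply/mem_set; apply: bigcapT_measurable => k.
  by apply: measurable_cylinder => //; exact: measurable_hole_region.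
by apply/mem_set; apply: measurable_hole_event => //; exact: lt_le_trans r1.
Qed.

End LowerBound.

Lemma expR1_le4 (R : realType) : expR 1 <= 4 :> R.
Proof.
have h : expR (1 / 2) <= 2 :> R.
  rewrite -[1 / 2]opprK expRN -[leRHS]invrK lef_pV2 ?posrE ?expR_gt0 ?invr_gt0 //.
  by apply: le_trans (expR_ge1Dx _); lra.
rewrite (_ : 1 = 1 / 2 + 1 / 2); last by field.
by rewrite expRD; apply: le_trans (ler_pM (expR_ge0 _) (expR_ge0 _) h h) _; lra.
Qed.

Lemma hole_probability_ge (R : realType) (r : R) (d : measure_display) (T : measurableType d)
    (P : probability T R) (zeta : nat -> T -> R[i]) :
  1 <= r -> (forall k, standard_complex_gaussian P (zeta k)) -> independent_sequence P zeta ->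
  ((expR (- (4000 * r ^+ 4)))%:E <= hole_probability P zeta r)%E.
Proof.
move=> r1 gauss indep; pose n := (Num.truncn (64 * r ^+ 2 * expR 1)).+1.
have r2 : 1 <= r ^+ 2 by exact: exprn_ege1.
have n_ge : 64 * r ^+ 2 * expR 1 <= n%:R by rewrite ltW // truncnS_gt.
have n_le : n%:R <= 64 * r ^+ 2 * expR 1 + 1.
  rewrite /n -natr1 lerD2r truncn_le //.
  by apply: mulr_ge0; [apply: mulr_ge0; rewrite ?sqr_ge0|exact: expR_ge0].
apply: (le_trans _ (hole_probability_ge_cost r1 n_ge gauss indep)).
rewrite lee_fin ler_expR lerN2 -[n.+1%:R]natr1.
have h1 : 64 * r ^+ 2 * expR 1 <= 64 * r ^+ 2 * 4.
  by rewrite ler_wpM2l ?expR1_le4 // mulr_ge0 // sqr_ge0.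
(* With e <= 4, n + 1 <= 256 r^2 + 2; then 12 * 258 = 3096, and 4000 also covers the additive 2. *)
have h2 : n%:R + 1 <= 258 * r ^+ 2.
  move: n_le h1 r2; move: (n%:R : R) (64 * r ^+ 2 * expR 1) (r ^+ 2) => y z x; lra.
have h3 : 12 * r ^+ 2 * (n%:R + 1) <= 12 * r ^+ 2 * (258 * r ^+ 2).
  by rewrite ler_wpM2l // mulr_ge0 // sqr_ge0.
have r4 : 1 <= r ^+ 4 by exact: exprn_ege1.
have E : 12 * r ^+ 2 * (258 * r ^+ 2) = 3096 * r ^+ 4 by ring.
move: h3; rewrite E; move: r4; move: (r ^+ 4) (12 * r ^+ 2 * (n%:R + 1)) => x y; lra.
Qed.

Theorem theorem1 (R : realType) :
  exists c C r0 : R, [/\ 0 < c, 0 < C & 0 < r0] /\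
  forall (d : measure_display) (T : measurableType d) (P : probability T R)
         (zeta : nat -> T -> R[i]),
    (forall k, standard_complex_gaussian P (zeta k)) ->
    independent_sequence P zeta ->
    forall r : R, r0 <= r ->
      ((expR (- (C * r ^+ 4)))%:E <= hole_probability P zeta r)%E /\
      (hole_probability P zeta r <= (expR (- (c * r ^+ 4)))%:E)%E.
Proof.
(* The threshold 100 makes r^2 >= 10^4, enough for n0 + 1 >= 64 and for 5 <= exp (r^4 / 1024). *)
exists 1024^-1, 4000, 100; split; first by split; rewrite ?invr_gt0 ltr0n.
move=> d T P zeta gauss indep r r100.
have r1 : 1 <= r by apply: le_trans r100; lra.
split; first exact: hole_probability_ge.
have r8 : 0 <= r ^+ 2 / 8 by rewrite divr_ge0 // sqr_ge0.
apply: (hole_probability_le r100 (n0 := Num.truncn (r ^+ 2 / 8))) => //.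
  by rewrite truncn_le.
by rewrite natr1 truncnS_gt.
Qed.
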